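(* Let $\psi : \mathbb{S}^{2}\rightarrow \mathbb{L}^4$ be a spacelike immersion which factors through the future lightcone $\Lambda^{+}$, i.e. $\psi(\mathbb{S}^2)\subset\Lambda^+$. Then, for every $u \in \mathbb{L}^4$ with $\langle u, u\rangle =-1$ and $u_{0}<0$, the area of the induced metric satisfies $$ \mathrm{area}(\mathbb{S}^{2},\langle\, ,\,\rangle)\leq 2\sqrt{\pi}\,\|\langle \psi, u\rangle\|, $$ where $\|\cdot\|$ denotes the $L^{2}$ norm on $\mathbb{S}^2$ with respect to the area element of the induced metric. Equality holds for some such $u$ if and only if, for this $u$, the function $\langle\psi,u\rangle$ is a positive constant $r$ and the surface is the totally umbilical round sphere $\mathbb{S}^{2}(u,r)$.
   Context: $\mathbb{L}^4$ is Lorentz-Minkowski spacetime: $\mathbb{R}^4$ with the metric $\langle\,,\,\rangle=-(dx_0)^2+(dx_1)^2+(dx_2)^2+(dx_3)^2$. $\mathbb{S}^2$ is the $2$-sphere as a smooth manifold. A smooth immersion into $\mathbb{L}^4$ is spacelike if the induced metric (also denoted $\langle\,,\,\rangle$) is Riemannian. $\Lambda^+=\{v\in\mathbb{L}^4:\langle v,v\rangle=0,\ v_0>0\}$ is the future lightcone. For $u\in\mathbb{L}^4$ with $\langle u,u\rangle=-1$, $u_0<0$, and $r>0$, $\mathbb{S}^2(u,r)=\{x\in\mathbb{L}^4:\langle x,x\rangle=0,\ \langle u,x\rangle=r\}\subset\Lambda^+$; ''the surface is $\mathbb{S}^2(u,r)$'' means $\psi(\mathbb{S}^2)=\mathbb{S}^2(u,r)$.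 *)

(* Defs.v *)
From HB Require Import structures.
From mathcomp Require Import all_boot all_order all_algebra.
From mathcomp Require Import ring.
From mathcomp Require Import all_classical all_reals all_analysis.

Set Implicit Arguments.
Unset Strict Implicit.
Unset Printing Implicit Defensive.

Import Order.TTheory GRing.Theory Num.Theory.
Import numFieldNormedType.Exports.

Local Open Scope classical_set_scope.
Local Open Scope ring_scope.

(* C^k maps between normed spaces: f is C^{k+1} when it is differentiable
   everywhere and z |-> 'd f z v is C^k for every direction v.  On a
   finite-dimensional domain this says that all iterated partial derivatives
   of order <= k exist and are continuous. *)
Fixpoint Ck {R : realType} {V W : normedModType R} (k : nat) (f : V -> W) : Prop :=
  match k with
  | 0 => continuous f
  | k'.+1 => (forall z, differentiable f z) /\
             (forall v, Ck k' (fun z => 'd f z v))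
  end.

Definition smooth {R : realType} {V W : normedModType R} (f : V -> W) : Prop :=
  forall k, Ck k f.

Section LorentzMinkowski.
Context {R : realType}.

Definition lorentz (x y : 'rV[R]_4) : R :=
  - (x ord0 ord0 * y ord0 ord0)
  + \sum_(i < 3) x ord0 (lift ord0 i) * y ord0 (lift ord0 i).

Definition future_lightcone : set 'rV[R]_4 :=
  [set v | lorentz v v = 0 /\ 0 < v ord0 ord0].

Definition lightcone_sphere (u : 'rV[R]_4) (r : R) : set 'rV[R]_4 :=
  [set x | lorentz x x = 0 /\ lorentz u x = r].

End LorentzMinkowski.

Definition sphere2 (R : realType) : set 'rV[R]_3 :=
  [set p | \sum_(i < 3) p ord0 i ^+ 2 = 1].
Arguments sphere2 : clear implicits.

Section Stereographic.
Context {R : realType}.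

(* Inverse of the stereographic projection from the pole (0, 0, 1) when
   b = false, and from (0, 0, -1) when b = true. *)
Definition stereo_coord (b : bool) (z : R * R) : 'rV[R]_3 :=
  let n := z.1 ^+ 2 + z.2 ^+ 2 in
  \row_(i < 3) nth 0 [:: 2 * z.1 / (n + 1);
                         2 * z.2 / (n + 1);
                         (-1) ^+ b * (n - 1) / (n + 1)] i.

Lemma stereo_coord_sphere2 (b : bool) (z : R * R) :
  stereo_coord b z \in sphere2 R.
Proof.
rewrite inE /sphere2 /= !big_ord_recl big_ord0 !mxE /=.
have n1 : z.1 ^+ 2 + z.2 ^+ 2 + 1 != 0.
  by rewrite gt_eqF// ltr_wpDl// addr_ge0// sqr_ge0.
by case: b; rewrite /= ?expr0 ?expr1; field.
Qed.

(* The two charts chart false and chart true form the standard atlas of the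
   sphere. *)
Definition chart (b : bool) (z : R * R) : sphere2 R :=
  SigSub (stereo_coord_sphere2 b z).

Implicit Types psi : sphere2 R -> 'rV[R]_4.

Definition smooth_on_sphere psi : Prop := forall b, smooth (psi \o chart b).

Definition immersion psi : Prop :=
  smooth_on_sphere psi /\
  forall b (z : R * R), injective ('d (psi \o chart b) z).

Definition induced_metric psi (b : bool) (z v w : R * R) : R :=
  lorentz ('d (psi \o chart b) z v) ('d (psi \o chart b) z w).

Definition spacelike psi : Prop :=
  forall b (z v : R * R), v != 0 -> 0 < induced_metric psi b z v v.

Definition gram_matrix psi (b : bool) (z : R * R) : 'M[R]_2 :=
  let e (i : 'I_2) : R * R := if i == ord0 then (1, 0) else (0, 1) in
  \matrix_(i, j) induced_metric psi b z (e i) (e j).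

Definition area_element psi (b : bool) (z : R * R) : R :=
  Num.sqrt (\det (gram_matrix psi b z)).

Local Open Scope ereal_scope.

(* The integral of f over the sphere for the area measure of the induced
   metric.  A single stereographic chart suffices: it covers the sphere up to
   one point, which has measure zero. *)
Definition area_integral psi (f : sphere2 R -> R) : \bar R :=
  \int[(@lebesgue_measure R \x @lebesgue_measure R)]_z
    (f (chart false z) * area_element psi false z)%:E.

Definition induced_area psi : \bar R := area_integral psi (fun=> 1%R).

Definition L2norm psi (f : sphere2 R -> R) : \bar R :=
  sqrte (area_integral psi (fun p => f p ^+ 2)%R).

End Stereographic.

(* Main.v *)
(** Idea. Put [h = <psi, u>], which is positive, and let [nu = psi / h + u] be
    the projection of [psi] to the unit sphere of [u^perp]. Since [psi] is null,
    the induced metric is [h^2] times the pull-back of the round metric by [nu],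
    so the area element is [h^2 |J|], with [J] the Jacobian of [nu]. If
    [int |J| = 4 pi], then Cauchy-Schwarz for the measure [|J| dz] gives
    [(int h^2 |J|)^2 <= 4 pi int h^4 |J|], with equality iff [h] is constant;
    [nu] is onto, because [<a, nu>] has a maximum on the sphere, at which
    [nu = a], so for constant [h = r] the image is all of [S^2(u, r)].

    That [int |J| = 4 pi] is Gauss-Bonnet for the pulled back round metric. On
    the plane of the first chart, orient the frame by [nu_x]; its connection form
    [omega] satisfies [d omega = - J dx dy], so by Green the integral of [J] over
    a large square is a boundary integral. In the second chart the frame winds
    twice around the pole, and the boundary integral tends to
    [2 * 2 pi], each of the four sides contributing [pi]. *)

Require Import Defs.
From HB Require Import structures.
From mathcomp Require Import all_boot all_order all_algebra.
From mathcomp Require Import ring lra.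
From mathcomp Require Import all_classical all_reals all_analysis.
From mathcomp Require Import measurable_realfun.

Set Implicit Arguments.
Unset Strict Implicit.
Unset Printing Implicit Defensive.

Import Order.TTheory GRing.Theory Num.Theory.
Import numFieldNormedType.Exports.

Local Open Scope classical_set_scope.
Local Open Scope ring_scope.

(** * Smooth functions on the plane *)

(** That [nu] is a diffeomorphism is never shown: only its Jacobian is known to vanish nowhere, and
    both the value 4 pi and surjectivity are drawn from that. Since [nu_x] has no zero, the frame is
    global on the plane; since J keeps its sign, the integral of |J| over a square is the absolute
    value of that of J. Squares are chosen because there Green's formula is Fubini plus the
    one-variable fundamental theorem.

    The charts differ by the inversion z -> z / |z|^2, whose differential sends (1, 0) to - z^2 /
    |z|^4 in complex notation. Far out, [nu_x] is thus a positive multiple of - z^2 read in the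
    coordinate frame of the second chart near its origin; hence the double winding. Freezing the
    metric at that origin leaves an explicit rational term of size 1 / A on the square of half-side
    A; the rest is o(1 / A), and a boundary of length 8 A makes it o(1). Along a side z goes from
    one diagonal to the other, so z^2 goes from a vector to a negative multiple of it: an angle pi
    in every inner product, whence the limit metric drops out. *)

Section Smoothness.
Context {R : realType} {V : normedModType R}.
Implicit Types (f g : V -> R).

Lemma Ck_continuous (W : normedModType R) k (f : V -> W) :
  Ck k f -> continuous f.
Proof. by case: k => [//|k] [fd _] z; exact/differentiable_continuous. Qed.

Lemma CkS (W : normedModType R) k (f : V -> W) : Ck k.+1 f -> Ck k f.
Proof.
elim: k f => [|k IHk] f; first exact: Ck_continuous.
by move=> [fd fk]; split=> // v; exact/IHk/fk.
Qed.

Lemma Ck_linear_comp (W W' : normedModType R) (L : {linear W -> W'}) k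
    (f : V -> W) : continuous L -> Ck k f -> Ck k (L \o f).
Proof.
move=> cL; elim: k f => [|k IHk] f.
  by move=> /= cf z; apply: continuous_comp; [exact: cf|exact: cL].
move=> [fd fk]; have Ld w : differentiable L w by exact: linear_differentiable.
split=> [z|v]; first exact: differentiable_comp.
rewrite (_ : (fun z => _) = L \o (fun z => 'd f z v)); first exact/IHk/fk.
by apply/funext => z; rewrite diff_comp//= diff_lin.
Qed.

Lemma Ck_cst k (c : R) : Ck k (fun _ : V => c).
Proof.
elim: k c => [|k IHk] c /=; first exact: cst_continuous.
split=> [z|v]; first exact: differentiable_cst.
rewrite (_ : (fun _ => _) = fun=> 0); first exact: IHk.
by apply/funext => z; rewrite diff_cst.
Qed.

Lemma CkD k f g : Ck k f -> Ck k g -> Ck k (fun z => f z + g z).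
Proof.
elim: k f g => [|k IHk] f g.
  by move=> cf cg z; apply: cvgD; [exact: cf|exact: cg].
move=> [fd fk] [gd gk]; split=> [z|v]; first exact: differentiableD.
rewrite (_ : (fun z => _) = (fun z => 'd f z v + 'd g z v)).
  exact: IHk (fk v) (gk v).
by apply/funext => z; rewrite (diffD (fd z) (gd z)).
Qed.

Lemma CkM k f g : Ck k f -> Ck k g -> Ck k (fun z => f z * g z).
Proof.
elim: k f g => [|k IHk] f g.
  by move=> cf cg z; apply: cvgM; [exact: cf|exact: cg].
move=> fk1 gk1; have [[fd fk] [gd gk]] := (fk1, gk1).
split=> [z|v]; first exact: differentiableM.
rewrite (_ : (fun z => _) = (fun z => f z * 'd g z v + g z * 'd f z v)).
  exact: CkD (IHk _ _ (CkS fk1) (gk v)) (IHk _ _ (CkS gk1) (fk v)).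
by apply/funext => z; rewrite (diffM (fd z) (gd z)).
Qed.

(** The derivative of f^-1 is - f^-2 df, again a polynomial in f^-1, so the induction hypothesis for
    f^-1 itself closes the step. *)
Lemma CkV k f : (forall z, f z != 0) -> Ck k f -> Ck k (fun z => (f z)^-1).
Proof.
move=> f0; elim: k => [|k IHk].
  by move=> cf z; apply: cvgV => //; exact: cf.
move=> fk1; have [fd fk] := fk1.
split=> [z|v]; first exact: differentiableV.
rewrite (_ : (fun z => _) =
    (fun z => -1 * ((f z)^-1 * (f z)^-1) * 'd f z v)).
  have fVk : Ck k (fun z => (f z)^-1) by exact/IHk/CkS.
  by apply: CkM; [apply: CkM; [exact: Ck_cst|exact: CkM]|exact: fk].
by apply/funext => z; rewrite diffV//= expr2 invfM mulN1r.
Qed.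

End Smoothness.

(* Sealed: conversion must not try to unify [pd1 g z] with [pd2 g z] by
   comparing the direction vectors. *)
HB.lock Definition pd1 {R : realType} (g : R * R -> R) (z : R * R) : R :=
  'd g z (1, 0).
HB.lock Definition pd2 {R : realType} (g : R * R -> R) (z : R * R) : R :=
  'd g z (0, 1).

Section PlanarCalculus.
Context {R : realType}.
Implicit Types (g h : R * R -> R) (z : R * R).

Lemma smooth_diff g z : smooth g -> differentiable g z.
Proof. by move=> /(_ 1)[]. Qed.

Lemma smooth_cont g : smooth g -> continuous g.
Proof. by move=> /(_ 0). Qed.

Lemma smooth_pd1 g : smooth g -> smooth (pd1 g).
Proof. by move=> sg k; rewrite unlock; have [_] := sg k.+1; exact. Qed.

Lemma smooth_pd2 g : smooth g -> smooth (pd2 g).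
Proof. by move=> sg k; rewrite unlock; have [_] := sg k.+1; exact. Qed.

Lemma diff_pd g z v : 'd g z v = v.1 * pd1 g z + v.2 * pd2 g z.
Proof.
have {1}-> : v = v.1 *: (1, 0) + v.2 *: (0, 1).
  by case: v => a b; congr pair; rewrite /= /GRing.scale/=; ring.
by rewrite linearD !linearZ !unlock.
Qed.

Lemma is_derive_curve g (a b : R -> R) (t a' b' : R) :
  differentiable g (a t, b t) -> is_derive t 1 a a' -> is_derive t 1 b b' ->
  is_derive t 1 (fun s => g (a s, b s))
    (a' * pd1 g (a t, b t) + b' * pd2 g (a t, b t)).
Proof.
move=> gd ad bd.
have da : differentiable a t by apply/derivable1_diffP.
have db : differentiable b t by apply/derivable1_diffP.
have dab : differentiable (fun s => (a s, b s)) t by exact: differentiable_pair.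
have dF : differentiable (g \o (fun s => (a s, b s))) t.
  exact: differentiable_comp.
have -> : (fun s => g (a s, b s)) = g \o (fun s => (a s, b s)) by [].
apply: DeriveDef; first exact: diff_derivable.
rewrite deriveE// diff_comp// /comp diff_pair// diff_pd /=.
by rewrite -!deriveE// !derive_val.
Qed.

Lemma is_derive_pd1 g (x y : R) : differentiable g (x, y) ->
  is_derive x 1 (fun s => g (s, y)) (pd1 g (x, y)).
Proof.
move=> gd; have := @is_derive_curve g id (cst y) x 1 0 gd
  (is_derive_id _ _) (is_derive_cst _ _ _).
by rewrite /= mul1r mul0r addr0.
Qed.

Lemma is_derive_pd2 g (x y : R) : differentiable g (x, y) ->
  is_derive y 1 (fun s => g (x, s)) (pd2 g (x, y)).
Proof.
move=> gd; have := @is_derive_curve g (cst x) id y 0 1 gd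
  (is_derive_cst _ _ _) (is_derive_id _ _).
by rewrite /= mul1r mul0r add0r.
Qed.

Lemma is_derive_unique (f : R -> R) (x a b : R) :
  is_derive x 1 f a -> is_derive x 1 f b -> a = b.
Proof. by move=> [_ <-] [_ <-]. Qed.

Lemma MVT_derivable (f df : R -> R) (a b : R) : a < b ->
  (forall x : R, is_derive x 1 f (df x)) ->
  exists2 c, c \in `]a, b[%R & f b - f a = df c * (b - a).
Proof.
move=> ab fd; apply: MVT => // x; apply: derivable_within_continuous => y _.
exact: ex_derive.
Qed.

(** Mean value theorem in the first variable for the difference of two horizontal slices, then in
    the second variable. The twin below takes the other order. *)
Lemma double_MVT g (x y e : R) : smooth g -> 0 < e ->
  exists2 p : R * R, (p.1 \in `]x, x + e[) /\ (p.2 \in `]y, y + e[) &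
  g (x + e, y + e) - g (x, y + e) - (g (x + e, y) - g (x, y)) =
    pd2 (pd1 g) p * e ^+ 2.
Proof.
move=> sg e0.
pose f s := g (s, y + e) - g (s, y).
have fd (s : R) : is_derive s 1 f (pd1 g (s, y + e) - pd1 g (s, y)).
  by apply: is_deriveB; apply: is_derive_pd1; exact: smooth_diff.
have [|c cI fE] := MVT_derivable _ fd (a := x) (b := x + e).
  by rewrite ltrDl.
have [||d dI hE] := @MVT_derivable (fun t => pd1 g (c, t))
    (fun t => pd2 (pd1 g) (c, t)) y (y + e).
- by rewrite ltrDl.
- by move=> t; apply: is_derive_pd2; exact/smooth_diff/smooth_pd1.
exists (c, d) => //=.
move: fE; rewrite hE /f [x + e]addrC [y + e]addrC !addrK => fE.
rewrite expr2 mulrA -fE; ring.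
Qed.

Lemma double_MVT' g (x y e : R) : smooth g -> 0 < e ->
  exists2 p : R * R, (p.1 \in `]x, x + e[) /\ (p.2 \in `]y, y + e[) &
  g (x + e, y + e) - g (x, y + e) - (g (x + e, y) - g (x, y)) =
    pd1 (pd2 g) p * e ^+ 2.
Proof.
move=> sg e0.
pose f t := g (x + e, t) - g (x, t).
have fd (t : R) : is_derive t 1 f (pd2 g (x + e, t) - pd2 g (x, t)).
  by apply: is_deriveB; apply: is_derive_pd2; exact: smooth_diff.
have [|d dI fE] := MVT_derivable _ fd (a := y) (b := y + e).
  by rewrite ltrDl.
have [||c cI hE] := @MVT_derivable (fun s => pd2 g (s, d))
    (fun s => pd1 (pd2 g) (s, d)) x (x + e).
- by rewrite ltrDl.
- by move=> s; apply: is_derive_pd1; exact/smooth_diff/smooth_pd2.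
exists (c, d) => //=.
move: fE; rewrite hE /f [x + e]addrC [y + e]addrC !addrK => fE.
rewrite expr2 mulrA -fE; ring.
Qed.

(** Over a small square with corner [z], one and the same second difference is the area times a
    nearby value of either mixed derivative; continuity of both at [z] identifies them. *)
Lemma pd_comm g z : smooth g -> pd1 (pd2 g) z = pd2 (pd1 g) z.
Proof.
move=> sg; apply/eqP; rewrite -subr_eq0 -normr_le0; apply/ler_addgt0Pr => _ /posnumP[e].
rewrite add0r.
have c1 := smooth_cont (smooth_pd1 (smooth_pd2 sg)).
have c2 := smooth_cont (smooth_pd2 (smooth_pd1 sg)).
have e2 : 0 < e%:num / 2 :> R by [].
have /cvgrPdist_lt/(_ _ e2)/nbhs_ballP[r1 r1p B1] := c1 z.
have /cvgrPdist_lt/(_ _ e2)/nbhs_ballP[r2 r2p B2] := c2 z.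
have [r r0 [rr1 rr2]] : exists2 r : R, 0 < r & r < r1 /\ r < r2.
  exists (Num.min r1 r2 / 2).
    by rewrite divr_gt0// lt_min r1p r2p.
  have m0 : 0 < Num.min r1 r2 by rewrite lt_min r1p r2p.
  by split; rewrite ltr_pdivrMr//; [have := ge_min r1 r1 r2|have := ge_min r2 r1 r2];
    rewrite lexx ?orbT; lra.
have near_z p s : r < s -> (p.1 \in `]z.1, z.1 + r[) -> (p.2 \in `]z.2, z.2 + r[) ->
    ball z s p.
  rewrite !in_itv/= => rs /andP[p11 p12] /andP[p21 p22].
  by split; rewrite /ball/= ltr_norml; apply/andP; split; lra.
have [p [p1 p2] pE] := double_MVT z.1 z.2 sg r0.
have [q [q1 q2] qE] := double_MVT' z.1 z.2 sg r0.
have pq : pd2 (pd1 g) p = pd1 (pd2 g) q.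
  by move: qE; rewrite pE => /(mulIf _) ->//; rewrite expf_neq0// gt_eqF.
have := B1 _ (near_z _ _ rr1 q1 q2); have := B2 _ (near_z _ _ rr2 p1 p2).
rewrite -pq /=; move: (pd2 _ p) (pd1 _ z) (pd2 _ z) => a b c.
rewrite !ltr_norml => /andP[h1 h2] /andP[h3 h4].
by rewrite ler_norml; apply/andP; split; lra.
Qed.

End PlanarCalculus.

(** * Vectors in space and the connection form *)

Section VectorAlgebra.
Context {R : realType}.
Implicit Types a b c n v w x y t : 'I_3 -> R.

Definition dot a b : R := a 0 * b 0 + a 1 * b 1 + a 2 * b 2.

Definition det3 a b c : R :=
  a 0 * (b 1 * c 2 - b 2 * c 1) - a 1 * (b 0 * c 2 - b 2 * c 0)
  + a 2 * (b 0 * c 1 - b 1 * c 0).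

Lemma dotC a b : dot a b = dot b a.
Proof. rewrite /dot; ring. Qed.

Lemma dot_ge0 a : 0 <= dot a a.
Proof. by rewrite /dot !addr_ge0 // -expr2 sqr_ge0. Qed.

Lemma forall_ord3 (P : 'I_3 -> Prop) : P 0 -> P 1 -> P 2 -> forall i, P i.
Proof.
move=> P0 P1 P2 [[|[|[|//]]] i3].
- by rewrite (_ : Ordinal _ = 0)//; exact/val_inj.
- by rewrite (_ : Ordinal _ = 1)//; exact/val_inj.
- by rewrite (_ : Ordinal _ = 2)//; exact/val_inj.
Qed.

Lemma dot_eq0 a : dot a a = 0 -> forall i, a i = 0.
Proof.
move=> /eqP; rewrite /dot -!expr2 !paddr_eq0 ?addr_ge0 ?sqr_ge0// !sqrf_eq0.
by move=> /andP[/andP[/eqP a0 /eqP a1] /eqP a2]; exact: forall_ord3.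
Qed.

(** The right-hand side is the Gram determinant, expanded along its first row. *)
Lemma det3_sqr a b c : det3 a b c ^+ 2 =
  dot a a * (dot b b * dot c c - dot b c ^+ 2)
  - dot a b * (dot a b * dot c c - dot a c * dot b c)
  + dot a c * (dot a b * dot b c - dot a c * dot b b).
Proof. rewrite /det3 /dot; ring. Qed.

Lemma det3_0 a b c : (forall i, b i = 0) -> det3 a b c = 0.
Proof. by move=> b0; rewrite /det3 !b0; ring. Qed.

Lemma dot_comb b c (p q : R) :
  dot (fun i => p * b i + q * c i) (fun i => p * b i + q * c i) =
  p ^+ 2 * dot b b + 2 * (p * q) * dot b c + q ^+ 2 * dot c c.
Proof. rewrite /dot; ring. Qed.

(* Both identities are the product rule for determinants applied to
   [det (n, v, n x v) = |v|^2]. *)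
Lemma det3_frame n v x y : dot n n = 1 -> dot n v = 0 ->
  dot v v * det3 n x y = dot v x * det3 n v y - dot v y * det3 n v x.
Proof.
move=> nn nv.
have : (dot n n * dot v v - dot n v ^+ 2) * det3 n x y =
    dot n n * (dot v x * det3 n v y - dot v y * det3 n v x)
    - dot n x * (dot n v * det3 n v y) + dot n y * (dot n v * det3 n v x).
  rewrite /dot /det3; ring.
by rewrite nn nv expr0n /= subr0 !mul1r !mul0r !mulr0 subr0 addr0.
Qed.

Lemma det3_normal n v w x : dot n n = 1 -> dot n v = 0 -> dot n w = 0 ->
  dot v v != 0 -> dot v v + dot n x = 0 -> det3 w v x = dot v v * det3 n v w.
Proof.
move=> nn nv nw v0 vx.
have H : (dot n n * dot v v - dot n v ^+ 2) * det3 w v x =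
    dot n w * (dot v v * det3 n v x)
    - dot n v * (dot v w * det3 n v x - dot v x * det3 n v w)
    + dot n x * (0 - dot v v * det3 n v w).
  rewrite /dot /det3; ring.
apply: (mulfI v0); move: H; rewrite nn nv nw expr0n /= subr0 !mul1r !mul0r.
move=> ->; rewrite -[dot n x](addKr (dot v v)) vx; ring.
Qed.

(** Here [n], [v], [w], [x], [y], [t] stand for N, N_x, N_y, N_xx, N_xy, N_xxy, and the two
    quotients are the derivatives of the connection components. The terms in [t] cancel; by
    [det3_frame] the terms in [det3 n x y] cancel against the derivatives of the denominators;
    [det3_normal] evaluates what is left. *)
Lemma curl_algebra n v w x y t : dot n n = 1 -> dot n v = 0 -> dot n w = 0 ->
  dot v v != 0 -> dot v v + dot n x = 0 ->
  ((det3 v v y + det3 n x y + det3 n v t) * dot v v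
     - det3 n v y * (dot x v + dot v x)) / dot v v ^+ 2
  - ((det3 w v x + det3 n y x + det3 n v t) * dot v v
     - det3 n v x * (dot y v + dot v y)) / dot v v ^+ 2
  = - det3 n v w.
Proof.
move=> nn nv nw v0 vx; rewrite (det3_normal nn nv nw v0 vx).
have vvy : det3 v v y = 0 by rewrite /det3; ring.
have yx : det3 n y x = - det3 n x y by rewrite /det3; ring.
rewrite vvy yx add0r (dotC x) (dotC y).
have H := det3_frame x y nn nv.
have -> : det3 n x y = (dot v x * det3 n v y - dot v y * det3 n v x) / dot v v.
  by rewrite -H mulrAC divff// mul1r.
by field.
Qed.

End VectorAlgebra.

Section VectorCalculus.
Context {R : realType}.
Implicit Types (N M F G H : R * R -> 'I_3 -> R) (z : R * R).

Definition vsmooth N := forall i, smooth (fun z => N z i).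
Definition vd1 N z i : R := pd1 (fun z => N z i) z.
Definition vd2 N z i : R := pd2 (fun z => N z i) z.

Lemma vsmooth_vd1 N : vsmooth N -> vsmooth (vd1 N).
Proof. by move=> sN i; exact: smooth_pd1. Qed.

Lemma vsmooth_vd2 N : vsmooth N -> vsmooth (vd2 N).
Proof. by move=> sN i; exact: smooth_pd2. Qed.

Lemma vd_comm N z : vsmooth N -> vd1 (vd2 N) z = vd2 (vd1 N) z.
Proof. by move=> sN; apply/funext => i; exact: pd_comm. Qed.

Definition is_vderive (f : R -> 'I_3 -> R) (t : R) (f' : 'I_3 -> R) :=
  forall i, is_derive t 1 (fun s => f s i) (f' i).

Lemma is_vderive_vd1 N (x y : R) : vsmooth N ->
  is_vderive (fun s => N (s, y)) x (vd1 N (x, y)).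
Proof. by move=> sN i; apply: is_derive_pd1; exact: smooth_diff. Qed.

Lemma is_vderive_vd2 N (x y : R) : vsmooth N ->
  is_vderive (fun s => N (x, s)) y (vd2 N (x, y)).
Proof. by move=> sN i; apply: is_derive_pd2; exact: smooth_diff. Qed.

Lemma is_derive_mul (f g : R -> R) (t a b : R) :
  is_derive t 1 f a -> is_derive t 1 g b ->
  is_derive t 1 (fun s => f s * g s) (a * g t + f t * b).
Proof.
move=> fa gb; apply: (is_derive_eq (is_deriveM fa gb)).
by rewrite /GRing.scale/= addrC [g t * a]mulrC.
Qed.

Lemma is_derive_add (f g : R -> R) (t a b : R) :
  is_derive t 1 f a -> is_derive t 1 g b ->
  is_derive t 1 (fun s => f s + g s) (a + b).
Proof. by move=> fa gb; exact: is_deriveD. Qed.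

Lemma is_derive_sub (f g : R -> R) (t a b : R) :
  is_derive t 1 f a -> is_derive t 1 g b ->
  is_derive t 1 (fun s => f s - g s) (a - b).
Proof. by move=> fa gb; exact: is_deriveB. Qed.

Lemma is_derive_div (f g : R -> R) (t a b : R) :
  is_derive t 1 f a -> is_derive t 1 g b -> g t != 0 ->
  is_derive t 1 (fun s => f s / g s) ((a * g t - f t * b) / g t ^+ 2).
Proof.
move=> fa gb g0.
have gV : is_derive t 1 (fun s => (g s)^-1) (- (g t) ^- 2 * b).
  apply: DeriveDef; first exact: derivableV.
  by rewrite deriveV// derive_val.
apply: (is_derive_eq (is_derive_mul fa gV)).
by field.
Qed.

Lemma is_derive_dot f g (t : R) a b : is_vderive f t a -> is_vderive g t b ->
  is_derive t 1 (fun s => dot (f s) (g s)) (dot a (g t) + dot (f t) b).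
Proof.
move=> fa gb; have ab i := is_derive_mul (fa i) (gb i).
have := is_derive_add (is_derive_add (ab 0) (ab 1)) (ab 2).
move/is_derive_eq; apply.
rewrite /dot; ring.
Qed.

Lemma is_derive_det3 f g h (t : R) a b c :
  is_vderive f t a -> is_vderive g t b -> is_vderive h t c ->
  is_derive t 1 (fun s => det3 (f s) (g s) (h s))
    (det3 a (g t) (h t) + det3 (f t) b (h t) + det3 (f t) (g t) c).
Proof.
move=> fa gb hc.
have minor i j := is_derive_sub (is_derive_mul (gb i) (hc j))
  (is_derive_mul (gb j) (hc i)).
have := is_derive_add (is_derive_sub (is_derive_mul (fa 0) (minor 1 2))
  (is_derive_mul (fa 1) (minor 0 2))) (is_derive_mul (fa 2) (minor 0 1)).
move/is_derive_eq; apply.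
rewrite /det3; ring.
Qed.

Lemma smooth_dot F G : vsmooth F -> vsmooth G ->
  smooth (fun z => dot (F z) (G z)).
Proof.
move=> sF sG k; rewrite /dot.
by do ?apply: CkD; apply: CkM; by [exact: sF|exact: sG].
Qed.

Lemma smooth_det3 F G H : vsmooth F -> vsmooth G -> vsmooth H ->
  smooth (fun z => det3 (F z) (G z) (H z)).
Proof.
move=> sF sG sH k.
pose m i j z := G z i * H z j + -1 * (G z j * H z i).
have mk i j : Ck k (m i j).
  have GH i' j' : Ck k (fun z => G z i' * H z j') by exact: CkM (sG _ _) (sH _ _).
  by apply: CkD (GH _ _) _; apply: CkM (Ck_cst _ _) (GH _ _).
have Fm i i' j' : Ck k (fun z => F z i * m i' j' z) by exact: CkM (sF _ _) _.
have -> : (fun z => det3 (F z) (G z) (H z)) = (fun z =>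
    (F z 0 * m 1 2 z + -1 * (F z 1 * m 0 2 z)) + F z 2 * m 0 1 z).
  by apply/funext => z; rewrite /det3 /m; ring.
by apply: CkD (Fm _ _ _); apply: CkD (Fm _ _ _) _; apply: CkM (Ck_cst _ _) _.
Qed.

Lemma smooth_div (f g : R * R -> R) : (forall z, g z != 0) ->
  smooth f -> smooth g -> smooth (fun z => f z / g z).
Proof. by move=> g0 sf sg k; exact: CkM (sf k) (CkV g0 (sg k)). Qed.

End VectorCalculus.

Section Connection.
Context {R : realType}.
Variable N : R * R -> 'I_3 -> R.
Hypothesis sN : vsmooth N.
Hypothesis N1 : forall z, dot (N z) (N z) = 1.

Definition jacobian z := det3 (N z) (vd1 N z) (vd2 N z).

(* The components of the Levi-Civita connection form [<dE_1, E_2>] of the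
   pulled back round metric, for the frame with [E_1 = N_x / |N_x|]. *)
Definition conn1 z :=
  det3 (N z) (vd1 N z) (vd1 (vd1 N) z) / dot (vd1 N z) (vd1 N z).
Definition conn2 z :=
  det3 (N z) (vd1 N z) (vd2 (vd1 N) z) / dot (vd1 N z) (vd1 N z).

Lemma dot_vd1 z : dot (N z) (vd1 N z) = 0.
Proof.
case: z => x y; have dN := is_vderive_vd1 x y sN.
have := is_derive_dot dN dN; rewrite (_ : (fun s => _) = cst 1); last first.
  by apply/funext => s; rewrite N1.
move=> H; have := is_derive_unique (is_derive_cst (1 : R) x 1) H.
by rewrite /= [dot (vd1 _ _) _]dotC => /esym/eqP; rewrite -mulr2n mulrn_eq0/= => /eqP.
Qed.

Lemma dot_vd2 z : dot (N z) (vd2 N z) = 0.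
Proof.
case: z => x y; have dN := is_vderive_vd2 x y sN.
have := is_derive_dot dN dN; rewrite (_ : (fun s => _) = cst 1); last first.
  by apply/funext => s; rewrite N1.
move=> H; have := is_derive_unique (is_derive_cst (1 : R) y 1) H.
by rewrite /= [dot (vd2 _ _) _]dotC => /esym/eqP; rewrite -mulr2n mulrn_eq0/= => /eqP.
Qed.

Lemma dot_vd11 z : dot (vd1 N z) (vd1 N z) + dot (N z) (vd1 (vd1 N) z) = 0.
Proof.
case: z => x y; have dN := is_vderive_vd1 x y sN.
have := is_derive_dot dN (is_vderive_vd1 x y (vsmooth_vd1 sN)).
rewrite (_ : (fun s => _) = cst 0); last by apply/funext => s; rewrite dot_vd1.
by move=> H; have := is_derive_unique (is_derive_cst (0 : R) x 1) H.
Qed.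

Hypothesis jacobian_neq0 : forall z, jacobian z != 0.

(** The frame has no singularity on the plane, so Green's formula needs no inner boundary. *)
Lemma dot_vd1_neq0 z : dot (vd1 N z) (vd1 N z) != 0.
Proof.
apply: contra_neq (jacobian_neq0 z) => /dot_eq0 v0.
exact: det3_0.
Qed.

Lemma smooth_conn1 : smooth conn1.
Proof.
have s1 := vsmooth_vd1 sN; apply: smooth_div dot_vd1_neq0 _ (smooth_dot s1 s1).
exact: smooth_det3 (vsmooth_vd1 s1).
Qed.

Lemma smooth_conn2 : smooth conn2.
Proof.
have s1 := vsmooth_vd1 sN; apply: smooth_div dot_vd1_neq0 _ (smooth_dot s1 s1).
exact: smooth_det3 (vsmooth_vd2 s1).
Qed.

Lemma curl_conn z : pd1 conn2 z - pd2 conn1 z = - jacobian z.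
Proof.
have s1 := vsmooth_vd1 sN.
case: z => x y; pose z := (x, y).
have d1 := is_derive_div
  (is_derive_det3 (is_vderive_vd1 x y sN) (is_vderive_vd1 x y s1)
     (is_vderive_vd1 x y (vsmooth_vd2 s1)))
  (is_derive_dot (is_vderive_vd1 x y s1) (is_vderive_vd1 x y s1)).
have d2 := is_derive_div
  (is_derive_det3 (is_vderive_vd2 x y sN) (is_vderive_vd2 x y s1)
     (is_vderive_vd2 x y (vsmooth_vd1 s1)))
  (is_derive_dot (is_vderive_vd2 x y s1) (is_vderive_vd2 x y s1)).
rewrite (is_derive_unique (is_derive_pd1 (smooth_diff (x, y) smooth_conn2))
  (d1 (dot_vd1_neq0 _))).
rewrite (is_derive_unique (is_derive_pd2 (smooth_diff (x, y) smooth_conn1))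
  (d2 (dot_vd1_neq0 _))).
(* The third derivatives in the two numerators are brought to the same order, so that they
   cancel. *)
rewrite vd_comm//; apply: curl_algebra (dot_vd1_neq0 _) (dot_vd11 _) => //.
- exact: dot_vd1.
- exact: dot_vd2.
Qed.

End Connection.

(** * Integrals over squares *)

Section PlanarIntegration.
Context {R : realType}.

Local Notation mu := (@lebesgue_measure R).

Definition seg (A : R) : set R := `[- A, A]%classic.
Definition square (A : R) : set (R * R) := seg A `*` seg A.

Lemma segE A x : seg A x = (`|x| <= A).
Proof. by rewrite /seg/= in_itv/= ler_norml. Qed.

Lemma measurable_seg A : measurable (seg A).
Proof. exact: measurable_itv. Qed.

Lemma measurable_square A : measurable (square A).
Proof. by apply: measurableX; exact: measurable_seg. Qed.

Lemma compact_seg A : compact (seg A).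
Proof. exact: segment_compact. Qed.

Lemma compact_square A : compact (square A).
Proof. by apply: compact_setX; exact: compact_seg. Qed.

(** Measurability on the plane refers to the product sigma-algebra, so an open set is written as a
    countable union of boxes with rational data. *)
Lemma open_measurable2 (U : set (R * R)) : open U -> measurable U.
Proof.
move=> oU.
pose box (a b c : rat) : set (R * R) :=
  `](ratr a - ratr c), (ratr a + ratr c)[ `*` `](ratr b - ratr c), (ratr b + ratr c)[.
have mbox a b c : measurable (box a b c).
  by apply: measurableX; exact: measurable_itv.
have -> : U = \bigcup_a \bigcup_b \bigcup_c
    (if `[< box a b c `<=` U >] then box a b c else set0).
  apply/seteqP; split => [[x y] Uxy|z [a _ [b _ [c _]]]]; last first.
    by case: ifPn => // /asboolP; apply.
  have /nbhs_ballP[e /= e0 eU] : nbhs (x, y) U by exact: open_nbhs_nbhs.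
  (* A half-side above e / 4 and a centre within e / 4 of the point put the point in the box; the
     half-side below e / 2 keeps the box in the ball of radius e. *)
  have /rat_in_itvoo[c] : e / 4 < e / 2.
    by rewrite ltr_pM2l// ltf_pV2 ?posrE// ltr_nat.
  rewrite in_itv/= => /andP[ec ce].
  have /rat_in_itvoo[a] : x - e / 4 < x + e / 4.
    by rewrite ltrD2l gtrN// divr_gt0.
  rewrite in_itv/= => /andP[ax xa].
  have /rat_in_itvoo[b] : y - e / 4 < y + e / 4.
    by rewrite ltrD2l gtrN// divr_gt0.
  rewrite in_itv/= => /andP[by_ yb].
  exists a => //; exists b => //; exists c => //.
  rewrite asboolT.
    by rewrite /box; split; rewrite /= in_itv/=; apply/andP; split; lra.
  move=> [x' y'] [] /=; rewrite !in_itv/= => /andP[h1 h2] /andP[h3 h4].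
  by apply: eU; split; rewrite /ball/= ltr_norml; apply/andP; split; lra.
do 3 apply: bigcupT_measurable_rat => ?.
by case: ifPn.
Qed.

Lemma continuous_measurable2 (g : R * R -> R) :
  continuous g -> measurable_fun setT g.
Proof.
move=> /continuousP cg; apply: (measurability _ (RGenOpens.measurableE R)).
move=> _ [_ [a [b ->] <-]]; rewrite setTI; apply: open_measurable2.
exact/cg/interval_open.
Qed.

Lemma square_fin A : ((mu \x mu) (square A) < +oo)%E.
Proof.
rewrite product_measure1E; [|exact: measurable_seg..].
have muA : (mu (seg A) < +oo)%E.
  by apply: compact_finite_measure; exact: compact_seg.
by rewrite lte_mul_pinfty// ge0_fin_numE.
Qed.

Lemma square_integrable (h : R * R -> R) A : continuous h ->
  (mu \x mu)%E.-integrable (square A) (EFin \o h).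
Proof.
move=> ch; apply: measurable_bounded_integrable.
- exact: measurable_square.
- exact: square_fin.
- by apply: measurable_funTS; exact: continuous_measurable2.
- have ch' : {within square A, continuous h} by exact: continuous_subspaceT.
  have /compact_bounded[M [_ mrt]] := continuous_compact ch' (@compact_square A).
  by exists M; split; rewrite ?num_real // => ? ? ? ?; exact: mrt.
Qed.

Lemma seg_integrable (f : R -> R) A : continuous f ->
  mu.-integrable (seg A) (EFin \o f).
Proof.
move=> cf; apply: continuous_compact_integrable; first exact: compact_seg.
exact: continuous_subspaceT.
Qed.

Lemma integral_square12 (h : R * R -> R) A : continuous h ->
  (\int[mu \x mu]_(z in square A) (h z)%:E =
   \int[mu]_(x in seg A) \int[mu]_(y in seg A) (h (x, y))%:E)%E.
Proof.
move=> ch; have ih := square_integrable A ch.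
rewrite integral_mkcond -integral12_prod_meas1; last first.
  by rewrite -integrable_mkcond//; exact: measurable_square.
rewrite [RHS]integral_mkcond; apply: eq_integral => x _.
rewrite /fubini_F patchE; case: ifPn => xA.
  rewrite [RHS]integral_mkcond; apply: eq_integral => y _.
  by rewrite !patchE /square in_setX xA.
by apply: integral0_eq => y _; rewrite patchE /square in_setX (negbTE xA).
Qed.

Lemma integral_square21 (h : R * R -> R) A : continuous h ->
  (\int[mu \x mu]_(z in square A) (h z)%:E =
   \int[mu]_(y in seg A) \int[mu]_(x in seg A) (h (x, y))%:E)%E.
Proof.
move=> ch; have ih := square_integrable A ch.
rewrite integral_mkcond -integral21_prod_meas1; last first.
  apply: (iffLR (integrable_mkcond _ _)) => //; exact: measurable_square.
rewrite [RHS]integral_mkcond; apply: eq_integral => y _.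
rewrite /fubini_G patchE; case: ifPn => yA.
  rewrite [RHS]integral_mkcond; apply: eq_integral => x _.
  by rewrite !patchE /square in_setX yA andbT.
by apply: integral0_eq => x _; rewrite patchE /square in_setX (negbTE yA) andbF.
Qed.

Lemma FTC_seg (f f' : R -> R) A : 0 < A -> continuous f' ->
  (forall x : R, is_derive x 1 f (f' x)) ->
  (\int[mu]_(x in seg A) (f' x)%:E = (f A - f (- A))%:E)%E.
Proof.
move=> A0 cf' fd.
have cf : continuous f.
  by move=> x; apply/differentiable_continuous/derivable1_diffP; exact: ex_derive.
rewrite EFinB; apply: continuous_FTC2.
- by rewrite gtrN.
- exact: continuous_subspaceT.
- split; first by move=> x _; exact: ex_derive.
  + exact/cvg_at_right_filter/cf.
  + exact/cvg_at_left_filter/cf.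
- by move=> x _; rewrite derive1E derive_val.
Qed.

Lemma EFin_Rintegral_seg (f : R -> R) A : continuous f ->
  (\int[mu]_(x in seg A) (f x)%:E = (\int[mu]_(x in seg A) f x)%R%:E)%E.
Proof.
move=> cf; rewrite /Rintegral fineK//; apply: integrable_fin_num.
  exact: measurable_seg.
exact: seg_integrable.
Qed.

Lemma continuous_slice1 (h : R * R -> R) (y : R) :
  continuous h -> continuous (fun x => h (x, y)).
Proof.
move=> ch x; have pc : {for x, continuous (fun s => (s, y))}.
  by apply/differentiable_continuous/differentiable_pair.
exact: (cvg_comp _ _ pc (ch (x, y))).
Qed.

Lemma continuous_slice2 (h : R * R -> R) (x : R) :
  continuous h -> continuous (fun y => h (x, y)).
Proof.
move=> ch y; have pc : {for y, continuous (fun s => (x, s))}.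
  by apply/differentiable_continuous/differentiable_pair.
exact: (cvg_comp _ _ pc (ch (x, y))).
Qed.

(** Each term is integrated first in the variable in which it is differentiated, whence the need for
    both orders of Fubini. *)
Lemma Green_square (P Q : R * R -> R) A : 0 < A -> smooth P -> smooth Q ->
  (\int[mu \x mu]_(z in square A) (pd1 Q z - pd2 P z)%:E =
   (\int[mu]_(y in seg A) (Q (A, y) - Q (- A, y))
    - \int[mu]_(x in seg A) (P (x, A) - P (x, - A)))%R%:E)%E.
Proof.
move=> A0 sP sQ.
have cQ := smooth_cont (smooth_pd1 sQ); have cP := smooth_cont (smooth_pd2 sP).
under eq_integral do rewrite EFinB.
rewrite integralB; [|exact: measurable_square|exact: square_integrable..].
have dif (f : R -> R) (g : R -> R) : continuous f -> continuous g ->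
    continuous (fun x => f x - g x).
  by move=> cf cg x; apply: cvgB; [exact: cf|exact: cg].
rewrite EFinB; congr (_ - _)%E.
  rewrite integral_square21// -EFin_Rintegral_seg; last first.
    by apply: dif; apply: continuous_slice2; exact: smooth_cont.
  apply: eq_integral => y _; apply: (@FTC_seg (fun x => Q (x, y))) => //.
    exact: continuous_slice1.
  by move=> x; apply: is_derive_pd1; exact: smooth_diff.
rewrite integral_square12// -EFin_Rintegral_seg; last first.
  by apply: dif; apply: continuous_slice1; exact: smooth_cont.
apply: eq_integral => x _; apply: (@FTC_seg (fun y => P (x, y))) => //.
  exact: continuous_slice2.
by move=> y; apply: is_derive_pd2; exact: smooth_diff.
Qed.

Lemma bigcup_square : \bigcup_n square n%:R = [set: R * R].
Proof.
apply/seteqP; split => // -[x y] _.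
exists (Num.truncn (Num.max `|x| `|y|)).+1 => //=.
have h := truncnS_gt (Num.max `|x| `|y|).
split; rewrite segE (le_trans _ (ltW h))//.
  by rewrite le_max lexx.
by rewrite le_max lexx orbT.
Qed.

Lemma cvg_integral_square (h : R * R -> R) : continuous h ->
  (forall z, 0 <= h z) ->
  (\int[mu \x mu]_(z in square n%:R) (h z)%:E @[n --> \oo] -->
   \int[mu \x mu]_z (h z)%:E)%E.
Proof.
move=> ch h0; rewrite -bigcup_square.
apply: ge0_nondecreasing_set_cvg_integral.
- apply/nondecreasing_seqP => n; rewrite subsetEset => -[x y].
  rewrite /square /setX/= !segE => -[xn yn].
  by split; rewrite (le_trans xn, le_trans yn)// ler_nat.
- by move=> n; exact: measurable_square.
- move=> n; apply/measurable_EFinP/measurable_funTS.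
  exact: continuous_measurable2.
- by move=> n x _; rewrite lee_fin.
Qed.

End PlanarIntegration.

(** * The turning of the frame along one side of a square *)

Section EdgeIntegral.
Context {R : realType}.
Local Notation mu := (@lebesgue_measure R).
Implicit Types (A E F G s t : R).

Definition qform E F G (a b : R) : R := E * (a * a) + 2 * F * (a * b) + G * (b * b).

(* Up to sign, the leading term of the connection form at the point of parameter
   [t] of a side of the square of half-side [A]; [E], [F], [G] are the
   coefficients of the metric at infinity and [D] its signed area density. *)
Definition edge E F G D A t : R :=
  2 * A * (A * A + t * t) * D / qform E F G (A * A - t * t) (2 * A * t).

(** For the symmetric matrix g of the form, Cayley-Hamilton gives tr(g) g(v, v) - det(g) |v|^2 = |g
    v|^2. *)
Lemma qform_lower E F G (a b : R) :
  (E * G - F ^+ 2) * (a ^+ 2 + b ^+ 2) <= (E + G) * qform E F G a b.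
Proof.
rewrite -subr_ge0 /qform (_ : _ - _ = (E * a + F * b) ^+ 2 + (F * a + G * b) ^+ 2).
  by rewrite addr_ge0// sqr_ge0.
ring.
Qed.

Lemma qform_edge_gt0 E F G A t : 0 < E -> 0 < E * G - F ^+ 2 -> 0 < A ->
  0 < qform E F G (A * A - t * t) (2 * A * t).
Proof.
move=> E0 d0 A0; have G0 : 0 < G.
  by rewrite -(pmulr_rgt0 _ E0); have := sqr_ge0 F; lra.
rewrite -(pmulr_rgt0 _ (addr_gt0 E0 G0)).
apply: lt_le_trans (qform_lower _ _ _ _ _); rewrite mulr_gt0//.
(* The two arguments are the real and imaginary parts of (A + i t)^2. *)
rewrite (_ : _ + _ = (A * A + t * t) ^+ 2); last by ring.
have := mulr_gt0 A0 A0; have := sqr_ge0 t; rewrite expr2 => h1 h2.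
by rewrite exprn_gt0// ltr_pwDl.
Qed.

Lemma derive_sqrB A t :
  is_derive t 1 (fun x => A * A - x * x) (0 - (1 * t + t * 1)).
Proof.
exact: is_derive_sub (is_derive_cst _ _ _)
  (is_derive_mul (is_derive_id _ _) (is_derive_id _ _)).
Qed.

Lemma derive_scale (k : R) t : is_derive t 1 (fun x => k * x) (0 * t + k * 1).
Proof. exact: is_derive_mul (is_derive_cst _ _ _) (is_derive_id _ _). Qed.

Lemma continuous_is_derive (f f' : R -> R) :
  (forall t, is_derive t 1 f (f' t)) -> continuous f.
Proof.
move=> fd t; apply/differentiable_continuous/derivable1_diffP.
exact: ex_derive.
Qed.

Lemma continuous_edge E F G D A : 0 < E -> 0 < E * G - F ^+ 2 -> 0 < A ->
  continuous (edge E F G D A).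
Proof.
move=> E0 d0 A0.
have q0 t := lt0r_neq0 (qform_edge_gt0 t E0 d0 A0).
have dX t := derive_sqrB A t; have dY t := derive_scale (2 * A) t.
have dc (k t : R) : is_derive t 1 (fun _ : R => k) 0 by exact: is_derive_cst.
have di t : is_derive t 1 (fun x : R => x) 1 by exact: is_derive_id.
have dn t := is_derive_mul (is_derive_mul (dc (2 * A) t)
  (is_derive_add (dc (A * A) t) (is_derive_mul (di t) (di t)))) (dc D t).
have dq t := is_derive_add (is_derive_add
  (is_derive_mul (dc E t) (is_derive_mul (dX t) (dX t)))
  (is_derive_mul (dc (2 * F) t) (is_derive_mul (dX t) (dY t))))
  (is_derive_mul (dc G t) (is_derive_mul (dY t) (dY t))).
move=> t; apply/differentiable_continuous/derivable1_diffP.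
exact: (@ex_derive _ _ _ _ _ _ _ (is_derive_div (dn t) (dq t) (q0 t))).
Qed.

(* The slope of the frame vector in an orthonormal basis: its [atan], the angle of
   the frame, is an antiderivative of [edge] and runs from [- pi / 2] to [pi / 2]
   between two corners. *)
Definition edge_arg F G s A t : R := (F + G * (2 * A * t / (A * A - t * t))) / s.

Lemma derive_atan_edge_arg E F G s A t :
  0 < E -> 0 < s -> s ^+ 2 = E * G - F ^+ 2 -> 0 < A -> - A < t < A ->
  is_derive t 1 (fun x => atan (edge_arg F G s A x)) (edge E F G s A t).
Proof.
move=> E0 s0 sE A0 /andP[At tA].
have d0 : 0 < E * G - F ^+ 2 by rewrite -sE exprn_gt0.
have q0 := lt0r_neq0 (qform_edge_gt0 t E0 d0 A0).
have X0 : A * A - t * t != 0.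
  by rewrite (_ : _ - _ = (A - t) * (t - - A)); [rewrite mulf_neq0// gt_eqF// subr_gt0|ring].
have dc (k : R) : is_derive t 1 (fun _ : R => k) 0 by exact: is_derive_cst.
have du := is_derive_mul (is_derive_add (dc F) (is_derive_mul (dc G)
  (is_derive_div (derive_scale (2 * A) t) (derive_sqrB A t) X0))) (dc s^-1).
have := is_derive1_comp (is_derive1_atan (edge_arg F G s A t)) du.
move/is_derive_eq; apply.
have G0 : G != 0.
  apply: contraTneq d0 => ->; rewrite mulr0 sub0r oppr_gt0 -leNgt; exact: sqr_ge0.
have s1 : s != 0 by rewrite gt_eqF.
have -> : 1 + edge_arg F G s A t ^+ 2 =
    G * qform E F G (A * A - t * t) (2 * A * t) / (s * (A * A - t * t)) ^+ 2.
  (* Completing the square: with X = A^2 - t^2 and Y = 2 A t, G times the form is s^2 X^2 + (F X + G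
     Y)^2, because s^2 = E G - F^2. *)
  have -> : G * qform E F G (A * A - t * t) (2 * A * t) =
      (s * (A * A - t * t)) ^+ 2 + (F * (A * A - t * t) + G * (2 * A * t)) ^+ 2.
    by rewrite exprMn sE /qform; ring.
  rewrite /edge_arg; field; by rewrite s1 X0.
rewrite /edge /GRing.scale/=; move: (qform _ _ _ _ _) q0 => q q0.
field; by rewrite s1 X0 G0 q0.
Qed.

Lemma atan_near_pihalf (e : R) : 0 < e -> exists M : R, forall x,
  (M < x -> `|pi / 2 - atan x| < e) /\ (x < - M -> `|- (pi / 2) - atan x| < e).
Proof.
move=> e0; have /cvgrPdist_lt/(_ _ e0)[M [_ MP]] := @cvgy_atan R.
exists M => x; split=> [/MP//|xM].
rewrite (_ : _ - _ = - (pi / 2 - atan (- x))); last by rewrite atanN; ring.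
by rewrite normrN; apply: MP; rewrite ltrNr.
Qed.

(** [edge_arg] tends to +oo at the corner: its difference with [M] is k / (s (A^2 - t^2)), where the
    numerator [k] is continuous with k(A) = 2 G A^2 > 0. The other corner is symmetric. *)
Lemma edge_arg_left F G s A (M : R) : 0 < G -> 0 < s -> 0 < A ->
  \forall t \near A^'-, M < edge_arg F G s A t.
Proof.
move=> G0 s0 A0.
pose k t := 2 * G * A * t - (M * s - F) * (A * A - t * t).
have ck : continuous k.
  apply: (@continuous_is_derive _ (fun t => (0 * t + 2 * G * A * 1) -
    (0 * (A * A - t * t) + (M * s - F) * (0 - (1 * t + t * 1))))) => t.
  apply: is_derive_sub; first exact: derive_scale.
  exact: is_derive_mul (is_derive_cst _ _ _) (derive_sqrB A t).
have kA : 0 < k A by rewrite /k subrr mulr0 subr0 !mulr_gt0.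
have kn : \forall t \near A^'-, 0 < k t.
  exact: (cvg_at_left_filter (ck A)) (lt_nbhsr kA).
near=> t.
have t0 : 0 < t by near: t; exact: nbhs_left_gt.
have tA : t < A by near: t; exact: nbhs_left_lt.
have kt : 0 < k t by near: t.
have X0 : 0 < A * A - t * t.
  by rewrite (_ : _ - _ = (A - t) * (t + A)); [rewrite mulr_gt0 ?subr_gt0 ?addr_gt0|ring].
rewrite -subr_gt0 (_ : _ - _ = k t / (s * (A * A - t * t))).
  by rewrite divr_gt0// mulr_gt0.
rewrite /edge_arg /k; field; by rewrite !gt_eqF.
Unshelve. all: by end_near. Qed.

Lemma edge_arg_right F G s A (M : R) : 0 < G -> 0 < s -> 0 < A ->
  \forall t \near (- A)^'+, edge_arg F G s A t < M.
Proof.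
move=> G0 s0 A0.
pose k t := (M * s - F) * (A * A - t * t) - 2 * G * A * t.
have ck : continuous k.
  apply: (@continuous_is_derive _ (fun t =>
    (0 * (A * A - t * t) + (M * s - F) * (0 - (1 * t + t * 1))) -
    (0 * t + 2 * G * A * 1))) => t.
  apply: is_derive_sub; last exact: derive_scale.
  exact: is_derive_mul (is_derive_cst _ _ _) (derive_sqrB A t).
have kA : 0 < k (- A) by rewrite /k mulrNN subrr mulr0 sub0r mulrN opprK !mulr_gt0.
have kn : \forall t \near (- A)^'+, 0 < k t.
  exact: (cvg_at_right_filter (ck (- A))) (lt_nbhsr kA).
near=> t.
have t0 : t < 0 by near: t; apply: nbhs_right_lt; rewrite oppr_lt0.
have tA : - A < t by near: t; exact: nbhs_right_gt.
have kt : 0 < k t by near: t.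
have X0 : 0 < A * A - t * t.
  rewrite (_ : _ - _ = (A - t) * (t - - A)); last by ring.
  by rewrite mulr_gt0 ?subr_gt0// (lt_trans t0).
rewrite -subr_gt0 (_ : _ - _ = k t / (s * (A * A - t * t))).
  by rewrite divr_gt0// mulr_gt0.
rewrite /edge_arg /k; field; by rewrite !gt_eqF.
Unshelve. all: by end_near. Qed.

Lemma integral_edge E F G s A :
  0 < E -> 0 < s -> s ^+ 2 = E * G - F ^+ 2 -> 0 < A ->
  \int[mu]_(t in seg A) edge E F G s A t = pi.
Proof.
move=> E0 s0 sE A0.
have d0 : 0 < E * G - F ^+ 2 by rewrite -sE exprn_gt0.
have G0 : 0 < G.
  by rewrite -(pmulr_rgt0 _ E0); have := sqr_ge0 F; lra.
(* At t = A and t = - A the denominator in [edge_arg] is 0 and the division returns 0, so [atan] of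
   it has the wrong value there. [Phi] prescribes the limits instead and is continuous up to the
   ends. *)
pose Phi t := if t <= - A then - (pi / 2) else
  if A <= t then pi / 2 else atan (edge_arg F G s A t).
have NAA : - A < A by rewrite gtrN.
have PhiA : Phi A = pi / 2 by rewrite /Phi lexx leNgt NAA.
have PhiNA : Phi (- A) = - (pi / 2) by rewrite /Phi lexx.
have Phi_in t : - A < t < A -> Phi t = atan (edge_arg F G s A t).
  by move=> /andP[h1 h2]; rewrite /Phi leNgt h1/= leNgt h2.
have dPhi t : t \in `]- A, A[ -> is_derive t 1 Phi (edge E F G s A t).
  move=> tA; apply: near_eq_is_derive (derive_atan_edge_arg E0 s0 sE A0 _).
    near=> x; apply/esym/Phi_in.
    suff : x \in `]- A, A[ by rewrite in_itv.
    by near: x; exact: near_in_itvoo.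
  by move: tA; rewrite in_itv.
rewrite /Rintegral (_ : (\int[mu]_(t in _) _)%E = (pi : R)%:E)//.
transitivity ((Phi A)%:E - (Phi (- A))%:E)%E; last first.
  by rewrite PhiA PhiNA -EFinB opprK -splitr.
apply: continuous_FTC2 => //.
- exact/continuous_subspaceT/continuous_edge.
- split.
  + by move=> t /dPhi dt; exact: ex_derive.
  + apply/cvgrPdist_lt => e /atan_near_pihalf[M MP]; rewrite PhiNA.
    have nM := @edge_arg_right F G s A (- M) G0 s0 A0.
    near=> t; rewrite Phi_in; first by apply: (MP _).2; near: t.
    apply/andP; split; near: t; first exact: nbhs_right_gt.
    exact: nbhs_right_lt.
  + apply/cvgrPdist_lt => e /atan_near_pihalf[M MP]; rewrite PhiA.
    have nM := @edge_arg_left F G s A M G0 s0 A0.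
    near=> t; rewrite Phi_in; first by apply: (MP _).1; near: t.
    apply/andP; split; near: t; last exact: nbhs_left_lt.
    exact: nbhs_left_gt.
- by move=> t /dPhi dt; rewrite derive1E derive_val.
Unshelve. all: by end_near. Qed.

End EdgeIntegral.

(** * The connection form near infinity *)

Section ConnectionAtInfinity.
Context {R : realType}.
Variables N M : R * R -> 'I_3 -> R.
Hypotheses (sN : vsmooth N) (sM : vsmooth M).
Hypothesis M1 : forall w, dot (M w) (M w) = 1.

Definition sqnorm (x y : R) : R := x * x + y * y.
Definition inversion (x y : R) : R * R := (x / sqnorm x y, y / sqnorm x y).

Hypothesis NM : forall x y, sqnorm x y != 0 -> N (x, y) = M (inversion x y).

(** In complex notation (Sa, Sb) = - z^2. Divided by |z|^4, (Sa, Sb) and (Sb, - Sa) are the columns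
    of the differential of the inversion. *)
Let Sa (x y : R) := y * y - x * x.
Let Sb (x y : R) := - 2 * x * y.

Lemma near_sqnorm (X Y : R -> R) (t p q : R) :
  is_derive t 1 X p -> is_derive t 1 Y q -> sqnorm (X t) (Y t) != 0 ->
  \forall s \near t, sqnorm (X s) (Y s) != 0.
Proof.
move=> dX dY n0.
have dn := is_derive_add (is_derive_mul dX dX) (is_derive_mul dY dY).
have cn : {for t, continuous (fun s => sqnorm (X s) (Y s))}.
  apply/differentiable_continuous/derivable1_diffP.
  exact: (@ex_derive _ _ _ _ _ _ _ dn).
exact: (cvgr_neq0 _ cn n0).
Qed.

Lemma is_derive_inversion (X Y : R -> R) (t p q : R) :
  is_derive t 1 X p -> is_derive t 1 Y q -> sqnorm (X t) (Y t) != 0 ->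
  is_derive t 1 (fun s => X s / sqnorm (X s) (Y s))
    ((p * Sa (X t) (Y t) + q * Sb (X t) (Y t)) / sqnorm (X t) (Y t) ^+ 2) /\
  is_derive t 1 (fun s => Y s / sqnorm (X s) (Y s))
    ((p * Sb (X t) (Y t) - q * Sa (X t) (Y t)) / sqnorm (X t) (Y t) ^+ 2).
Proof.
move=> dX dY n0.
have dn : is_derive t 1 (fun s => sqnorm (X s) (Y s)) _ :=
  is_derive_add (is_derive_mul dX dX) (is_derive_mul dY dY).
split.
  apply: (is_derive_eq (is_derive_div dX dn n0)).
  by congr (_ / _); rewrite /Sa /Sb /sqnorm; ring.
apply: (is_derive_eq (is_derive_div dY dn n0)).
by congr (_ / _); rewrite /Sa /Sb /sqnorm; ring.
Qed.

Lemma vd1_inversion (x y : R) i : sqnorm x y != 0 ->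
  vd1 N (x, y) i = (Sa x y * vd1 M (inversion x y) i
    + Sb x y * vd2 M (inversion x y) i) / sqnorm x y ^+ 2.
Proof.
move=> n0.
have dX : is_derive x 1 (fun s : R => s) 1 by exact: is_derive_id.
have dY : is_derive x 1 (fun=> y) 0 by exact: is_derive_cst.
have [da db] := is_derive_inversion dX dY n0.
have dM := is_derive_curve (smooth_diff _ (sM i)) da db.
have dN : is_derive x 1 (fun s => N (s, y) i) _ := near_eq_is_derive _ dM.
rewrite -(is_derive_unique (dN _) (is_vderive_vd1 x y sN i)).
  rewrite /vd1 /vd2 /inversion; field; exact: n0.
near=> s; rewrite NM//; near: s; exact: near_sqnorm dX dY n0.
Unshelve. all: by end_near. Qed.

(* [N_x] times the positive factor [sqnorm x y ^+ 2]; the connection form of the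
   frame is not affected by such a rescaling. *)
Definition rescaled (x y : R) i : R :=
  Sa x y * vd1 M (inversion x y) i + Sb x y * vd2 M (inversion x y) i.

(** Derivative of [rescaled] along a curve through (x, y) with velocity (p, q). The first two terms,
    of the order of |z|, differentiate [Sa] and [Sb] and carry the winding; (J1, J2) is the velocity
    of the inverted curve, of order |z|^-2, so the other terms stay bounded. *)
Definition rescaled_deriv (x y p q : R) i : R :=
  let w := inversion x y in
  let J1 := (p * Sa x y + q * Sb x y) / sqnorm x y ^+ 2 in
  let J2 := (p * Sb x y - q * Sa x y) / sqnorm x y ^+ 2 in
  2 * (y * q - x * p) * vd1 M w i - 2 * (x * q + y * p) * vd2 M w i
  + Sa x y * (J1 * vd1 (vd1 M) w i + J2 * vd2 (vd1 M) w i)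
  + Sb x y * (J1 * vd1 (vd2 M) w i + J2 * vd2 (vd2 M) w i).

Lemma derive_rescaled (X Y : R -> R) (t p q : R) i :
  is_derive t 1 X p -> is_derive t 1 Y q -> sqnorm (X t) (Y t) != 0 ->
  is_derive t 1 (fun s => rescaled (X s) (Y s) i)
    (rescaled_deriv (X t) (Y t) p q i).
Proof.
move=> dX dY n0.
have [da db] := is_derive_inversion dX dY n0.
have d1 := is_derive_curve (smooth_diff _ (vsmooth_vd1 sM i)) da db.
have d2 := is_derive_curve (smooth_diff _ (vsmooth_vd2 sM i)) da db.
have dSa := is_derive_sub (is_derive_mul dY dY) (is_derive_mul dX dX).
have dc : is_derive t 1 (fun=> -2 : R) 0 by exact: is_derive_cst.
have dSb := is_derive_mul (is_derive_mul dc dX) dY.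
apply: (is_derive_eq (is_derive_add (is_derive_mul dSa d1)
  (is_derive_mul dSb d2))).
rewrite /rescaled_deriv /Sa /Sb /vd1 /vd2 /inversion; ring.
Qed.

Lemma derive_vd1_inversion (X Y : R -> R) (t p q : R) :
  is_derive t 1 X p -> is_derive t 1 Y q -> sqnorm (X t) (Y t) != 0 ->
  exists2 lm : R * R, lm.1 != 0 /\
    (forall i, vd1 N (X t, Y t) i = lm.1 * rescaled (X t) (Y t) i) &
    is_vderive (fun s => vd1 N (X s, Y s)) t
      (fun i => lm.1 * rescaled_deriv (X t) (Y t) p q i
                + lm.2 * rescaled (X t) (Y t) i).
Proof.
move=> dX dY n0.
have dn := is_derive_add (is_derive_mul dX dX) (is_derive_mul dY dY).
have dn2 := is_derive_mul dn dn.
have n2 : sqnorm (X t) (Y t) * sqnorm (X t) (Y t) != 0 by rewrite mulf_neq0.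
(* The factor |z|^-4 and its derivative along the curve. *)
exists ((sqnorm (X t) (Y t) ^+ 2)^-1,
  - (2 * (2 * (X t * p + Y t * q))) / sqnorm (X t) (Y t) ^+ 3); last first.
  move=> i /=.
  have dq := is_derive_div (derive_rescaled i dX dY n0) dn2 n2.
  apply: near_eq_is_derive (is_derive_eq dq _).
    near=> s; rewrite /= vd1_inversion ?expr2//.
    by near: s; exact: near_sqnorm dX dY n0.
  move: (rescaled _ _ _) (rescaled_deriv _ _ _ _ _) => a b.
  move: n0; rewrite /sqnorm => n0; field; exact: n0.
split=> [|i /=]; first by rewrite invr_neq0// expf_neq0.
by rewrite vd1_inversion// mulrC.
Unshelve. all: by end_near. Qed.

(** The multiple of [v] added to the derivative drops out of the determinant, and the factors l^2
    cancel. *)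
Lemma det3_rescale (n v v' : 'I_3 -> R) (l m : R) : l != 0 ->
  det3 n (fun i => l * v i) (fun i => l * v' i + m * v i) /
    dot (fun i => l * v i) (fun i => l * v i) = det3 n v v' / dot v v.
Proof.
move=> l0.
have -> : det3 n (fun i => l * v i) (fun i => l * v' i + m * v i) =
  l ^+ 2 * det3 n v v' by rewrite /det3; ring.
have -> : dot (fun i => l * v i) (fun i => l * v i) = l ^+ 2 * dot v v.
  by rewrite /dot; ring.
by rewrite -mulf_div divff ?mul1r// expf_neq0.
Qed.

Definition conn_at_inversion (x y p q : R) : R :=
  det3 (M (inversion x y)) (rescaled x y) (rescaled_deriv x y p q) /
  dot (rescaled x y) (rescaled x y).

Lemma conn1_inversion (x y : R) : sqnorm x y != 0 ->
  conn1 N (x, y) = conn_at_inversion x y 1 0.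
Proof.
move=> n0.
have dX : is_derive x 1 (fun s : R => s) 1 by exact: is_derive_id.
have dY : is_derive x 1 (fun=> y) 0 by exact: is_derive_cst.
have [[l m] /= [l0 vE] dv] := derive_vd1_inversion dX dY n0.
rewrite /conn1 NM//.
have -> : vd1 (vd1 N) (x, y) = fun i =>
    l * rescaled_deriv x y 1 0 i + m * rescaled x y i.
  apply/funext => i.
  exact: is_derive_unique (is_vderive_vd1 x y (vsmooth_vd1 sN) i) (dv i).
have -> : vd1 N (x, y) = fun i => l * rescaled x y i by exact/funext.
exact: det3_rescale.
Qed.

Lemma conn2_inversion (x y : R) : sqnorm x y != 0 ->
  conn2 N (x, y) = conn_at_inversion x y 0 1.
Proof.
move=> n0.
have dX : is_derive y 1 (fun=> x) 0 by exact: is_derive_cst.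
have dY : is_derive y 1 (fun s : R => s) 1 by exact: is_derive_id.
have [[l m] /= [l0 vE] dv] := derive_vd1_inversion dX dY n0.
rewrite /conn2 NM//.
have -> : vd2 (vd1 N) (x, y) = fun i =>
    l * rescaled_deriv x y 0 1 i + m * rescaled x y i.
  apply/funext => i.
  exact: is_derive_unique (is_vderive_vd2 x y (vsmooth_vd1 sN) i) (dv i).
have -> : vd1 N (x, y) = fun i => l * rescaled x y i by exact/funext.
exact: det3_rescale.
Qed.

(* First fundamental form of [M]. *)
Definition fffE w := dot (vd1 M w) (vd1 M w).
Definition fffF w := dot (vd1 M w) (vd2 M w).
Definition fffG w := dot (vd2 M w) (vd2 M w).

Let rem_coeff w : R :=
  `|det3 (M w) (vd1 M w) (vd1 (vd1 M) w)| + `|det3 (M w) (vd1 M w) (vd2 (vd1 M) w)|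
  + `|det3 (M w) (vd1 M w) (vd1 (vd2 M) w)| + `|det3 (M w) (vd1 M w) (vd2 (vd2 M) w)|
  + `|det3 (M w) (vd2 M w) (vd1 (vd1 M) w)| + `|det3 (M w) (vd2 M w) (vd2 (vd1 M) w)|
  + `|det3 (M w) (vd2 M w) (vd1 (vd2 M) w)| + `|det3 (M w) (vd2 M w) (vd2 (vd2 M) w)|.

Lemma jacobian_sqr w : jacobian M w ^+ 2 = fffE w * fffG w - fffF w ^+ 2.
Proof.
rewrite /jacobian det3_sqr M1 (dot_vd1 sM M1) (dot_vd2 sM M1).
rewrite /fffE /fffF /fffG; ring.
Qed.

Lemma dot_rescaled x y : dot (rescaled x y) (rescaled x y) =
  let w := inversion x y in qform (fffE w) (fffF w) (fffG w) (Sa x y) (Sb x y).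
Proof. by rewrite /= /qform /rescaled dot_comb /fffE /fffF /fffG; ring. Qed.

(** Used with [a], [b] the first and [c], [d], [e], [f] the second derivatives of M. The first term
    is the leading one; the eight others are those measured by [rem_coeff]. *)
Lemma det3_expand (n a b c d e f : 'I_3 -> R) (s1 s2 k1 k2 j1 j2 : R) :
  det3 n (fun i => s1 * a i + s2 * b i)
    (fun i => k1 * a i - k2 * b i + s1 * (j1 * c i + j2 * d i)
                                   + s2 * (j1 * e i + j2 * f i)) =
  - (s1 * k2 + s2 * k1) * det3 n a b +
  (s1 * s1 * j1 * det3 n a c + s1 * s1 * j2 * det3 n a d
   + s1 * s2 * j1 * det3 n a e + s1 * s2 * j2 * det3 n a f
   + s2 * s1 * j1 * det3 n b c + s2 * s1 * j2 * det3 n b d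
   + s2 * s2 * j1 * det3 n b e + s2 * s2 * j2 * det3 n b f).
Proof. rewrite /det3; ring. Qed.

Lemma norm_Sab x y : `|Sa x y| <= sqnorm x y /\ `|Sb x y| <= sqnorm x y.
Proof.
have := sqr_ge0 x; have := sqr_ge0 y; have := sqr_ge0 (x - y).
have := sqr_ge0 (x + y); rewrite /Sa /Sb /sqnorm !ler_norml.
rewrite !expr2 => h1 h2 h3 h4.
by split; apply/andP; split; lra.
Qed.

(** The coefficient of the leading term is exactly 2 |z|^2 (x q - y p). In each of the eight other
    terms two factors are at most |z|^2 and one at most |z|^-2. *)
Lemma det3_rescaled_bound x y p q : 0 < sqnorm x y -> `|p| + `|q| <= 1 ->
  `|det3 (M (inversion x y)) (rescaled x y) (rescaled_deriv x y p q)
    - 2 * sqnorm x y * (x * q - y * p) * jacobian M (inversion x y)| <=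
  sqnorm x y * rem_coeff (inversion x y).
Proof.
move=> n0 pq1; set w := inversion x y.
rewrite /rescaled /rescaled_deriv -/w det3_expand -/(jacobian M w).
set J1 := _ / _; set J2 := _ / _.
have [ha hb] := norm_Sab x y.
have hJ (u v : R) : `|u| <= sqnorm x y -> `|v| <= sqnorm x y ->
    `|(p * u + q * v) / sqnorm x y ^+ 2| <= (sqnorm x y)^-1.
  move=> hu hv; have r2 : 0 < sqnorm x y ^+ 2 by rewrite exprn_gt0.
  rewrite normrM normfV (gtr0_norm r2).
  rewrite expr2 invfM mulrA -[X in _ <= X]mul1r ler_pM2r ?invr_gt0//.
  rewrite ler_pdivrMr// mul1r (le_trans (ler_normD _ _))// !normrM.
  apply: le_trans (lerD (ler_wpM2l (normr_ge0 _) hu) (ler_wpM2l (normr_ge0 _) hv)) _.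
  by rewrite -mulrDl ler_piMl// ltW.
have hJ1 : `|J1| <= (sqnorm x y)^-1 by exact: hJ.
have hJ2 : `|J2| <= (sqnorm x y)^-1.
  by rewrite /J2 -mulrN; apply: hJ => //; rewrite normrN.
have term (u v j d : R) : `|u| <= sqnorm x y -> `|v| <= sqnorm x y ->
    `|j| <= (sqnorm x y)^-1 -> `|u * v * j * d| <= sqnorm x y * `|d|.
  move=> hu hv hj; rewrite !normrM ler_wpM2r//.
  rewrite -[X in _ <= X](mulfK (lt0r_neq0 n0)).
  by rewrite !ler_pM ?mulr_ge0// mulr_ge0.
rewrite (_ : - _ * jacobian M w = 2 * sqnorm x y * (x * q - y * p) * jacobian M w);
  last by rewrite /Sa /Sb /sqnorm; ring.
rewrite addrAC subrr add0r /rem_coeff !(mulrDr (sqnorm x y)).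
by do 7 (apply: le_trans (ler_normD _ _) _; apply: lerD; last by apply: term);
  apply: term.
Qed.

(** Determinant over trace: a lower bound for the smaller eigenvalue of the first fundamental
    form. *)
Let lam w : R := jacobian M w ^+ 2 / (fffE w + fffG w).

Lemma ffE_gt0 w : jacobian M w != 0 -> 0 < fffE w /\ 0 < fffG w.
Proof.
move=> D0; have D2 : 0 < jacobian M w ^+ 2 by rewrite exprn_even_gt0.
rewrite jacobian_sqr in D2; have := sqr_ge0 (fffF w) => F2.
have EG : 0 < fffE w * fffG w by lra.
have E0 : 0 <= fffE w by exact: dot_ge0.
have G0 : 0 <= fffG w by exact: dot_ge0.
split; rewrite lt_neqAle ?E0 ?G0 andbT; apply: contraTneq EG => <-;
  by rewrite ?mul0r ?mulr0 ltxx.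
Qed.

Lemma lam_gt0 w : jacobian M w != 0 -> 0 < lam w.
Proof.
move=> D0; have [E0 G0] := ffE_gt0 D0.
by apply: divr_gt0; [rewrite exprn_even_gt0|exact: addr_gt0].
Qed.

Lemma qform_lam w (x y : R) : jacobian M w != 0 ->
  lam w * sqnorm x y ^+ 2 <= qform (fffE w) (fffF w) (fffG w) (Sa x y) (Sb x y).
Proof.
move=> D0; have [E0 G0] := ffE_gt0 D0.
have EG0 := addr_gt0 E0 G0.
rewrite /lam mulrAC ler_pdivrMr// [X in _ <= X]mulrC jacobian_sqr.
have := qform_lower (fffE w) (fffF w) (fffG w) (Sa x y) (Sb x y).
congr (_ <= _); congr (_ * _); rewrite /Sa /Sb /sqnorm; ring.
Qed.

(** Angular velocity of - z^2, in the metric of M at [w] and signed by the Jacobian, when z moves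
    with velocity (p, q): the determinant of this vector and its derivative is 2 |z|^2 (x q - y p).
    It is used at [w = 0], the image of infinity. *)
Definition conn_main (w : R * R) (x y p q : R) : R :=
  2 * sqnorm x y * (x * q - y * p) * jacobian M w /
  qform (fffE w) (fffF w) (fffG w) (Sa x y) (Sb x y).

Let variation w : R := `|fffE w - fffE 0| + `|fffF w - fffF 0| + `|fffG w - fffG 0|.

(** [err1], the cost of freezing the metric, tends to 0 at the origin; [err2], the contribution of
    the second derivatives, merely stays bounded, but it comes with one more power of 1 / A. *)
Let err1 w : R := 2 * (`|jacobian M w - jacobian M 0| / lam w +
  `|jacobian M 0| * variation w / (lam w * lam 0)).
Let err2 w : R := rem_coeff w / lam w.

Lemma conn_estimate A x y p q (w := inversion x y) :
  jacobian M 0 != 0 -> jacobian M w != 0 -> 0 < A ->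
  `|x| <= A -> `|y| <= A -> A ^+ 2 <= sqnorm x y -> `|p| + `|q| <= 1 ->
  `|conn_at_inversion x y p q - conn_main 0 x y p q| <=
  err1 w / A + err2 w / A ^+ 2.
Proof.
move=> D0 Dw A0 xA yA Ar pq1.
have A2 : 0 < A ^+ 2 by rewrite exprn_gt0.
have n0 : 0 < sqnorm x y by exact: lt_le_trans Ar.
have l0 := lam_gt0 D0; have lw := lam_gt0 Dw.
have q0 := qform_lam x y D0; have qw := qform_lam x y Dw.
rewrite /conn_at_inversion /conn_main dot_rescaled /= -/w.
set r := sqnorm x y in n0 Ar q0 qw *.
set Q0 := qform (fffE 0) _ _ _ _ in q0 *; set Qw := qform (fffE w) _ _ _ _ in qw *.
have r2 : 0 < r ^+ 2 by rewrite exprn_gt0.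
have Q0p : 0 < Q0 by apply: lt_le_trans q0; rewrite mulr_gt0.
have Qwp : 0 < Qw by apply: lt_le_trans qw; rewrite mulr_gt0.
have rem := det3_rescaled_bound n0 pq1; rewrite -/w -/r in rem.
set det := det3 _ _ _ in rem *.
set k := x * q - y * p in rem *.
have kA : `|k| <= A.
  apply: le_trans (ler_normB _ _) _; rewrite !normrM.
  apply: (@le_trans _ _ (A * `|q| + A * `|p|)).
    by apply: lerD; rewrite ler_wpM2r.
  by rewrite -mulrDr addrC ler_piMr// ltW.
have QQ : `|Q0 - Qw| <= variation w * r ^+ 2.
  have [ha hb] := norm_Sab x y; rewrite -/r in ha hb.
  have aa : `|Sa x y * Sa x y| <= r ^+ 2 by rewrite normrM expr2 ler_pM.
  have bb : `|Sb x y * Sb x y| <= r ^+ 2 by rewrite normrM expr2 ler_pM.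
  have ab : `|2 * (Sa x y * Sb x y)| <= r ^+ 2.
    have h1 := sqr_ge0 (Sa x y + Sb x y); have h2 := sqr_ge0 (Sa x y - Sb x y).
    have rE : r ^+ 2 = Sa x y * Sa x y + Sb x y * Sb x y.
      by rewrite /r /Sa /Sb /sqnorm; ring.
    by rewrite rE ler_norml; apply/andP; split; rewrite !expr2 in h1 h2; lra.
  have QE : Qw - Q0 = (fffE w - fffE 0) * (Sa x y * Sa x y)
    + (fffF w - fffF 0) * (2 * (Sa x y * Sb x y))
    + (fffG w - fffG 0) * (Sb x y * Sb x y).
    by rewrite /Q0 /Qw /qform; ring.
  rewrite distrC /variation !mulrDl QE.
  apply: le_trans (ler_normD _ _) _; apply: lerD; last first.
    by rewrite normrM ler_wpM2l.
  by apply: le_trans (ler_normD _ _) _; apply: lerD; rewrite normrM ler_wpM2l.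
(* Three replacements are separated: the numerator by its leading term, then the Jacobian, then the
   quadratic form, by their values at the origin. *)
have -> : det / Qw - 2 * r * k * jacobian M 0 / Q0 =
    (det - 2 * r * k * jacobian M w) / Qw +
    2 * r * k * ((jacobian M w - jacobian M 0) / Qw +
                 jacobian M 0 * (Q0 - Qw) / (Qw * Q0)).
  by field; rewrite !gt_eqF.
have iQw : Qw^-1 <= (lam w)^-1 / r ^+ 2.
  by rewrite -invfM lef_pV2 ?posrE// mulr_gt0.
have iQ0 : Q0^-1 <= (lam 0)^-1 / r ^+ 2.
  by rewrite -invfM lef_pV2 ?posrE// mulr_gt0.
have ri : r^-1 <= (A ^+ 2)^-1 by rewrite lef_pV2 ?posrE.
have t1 : `|(det - 2 * r * k * jacobian M w) / Qw| <= err2 w / A ^+ 2.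
  rewrite normrM normfV (gtr0_norm Qwp).
  apply: le_trans (ler_pM _ _ rem iQw) _ => //; first by rewrite invr_ge0 ltW.
  have -> : r * rem_coeff w * ((lam w)^-1 / r ^+ 2) = err2 w * r^-1.
    by rewrite /err2; field; rewrite !gt_eqF.
  apply: ler_wpM2l => //; apply: divr_ge0; last exact: ltW.
  by rewrite /rem_coeff !addr_ge0.
have t2 : `|(jacobian M w - jacobian M 0) / Qw +
    jacobian M 0 * (Q0 - Qw) / (Qw * Q0)| <= err1 w / (2 * r ^+ 2).
  apply: le_trans (ler_normD _ _) _.
  rewrite (_ : err1 w / _ = `|jacobian M w - jacobian M 0| * ((lam w)^-1 / r ^+ 2)
    + `|jacobian M 0| * (variation w * r ^+ 2) *
      (((lam w)^-1 / r ^+ 2) * ((lam 0)^-1 / r ^+ 2))); last first.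
    by rewrite /err1; field; rewrite !gt_eqF.
  rewrite !normrM !normfV normrM (gtr0_norm Qwp) (gtr0_norm Q0p) invfM.
  have iw : 0 <= Qw^-1 by rewrite invr_ge0 ltW.
  have i0 : 0 <= Q0^-1 by rewrite invr_ge0 ltW.
  apply: lerD; first by rewrite ler_wpM2l.
  by apply: ler_pM; rewrite ?mulr_ge0//; [rewrite ler_wpM2l|rewrite ler_pM].
apply: le_trans (ler_normD _ _) _; rewrite addrC; apply: lerD => //.
rewrite normrM.
have rr0 : 0 <= 2 * r by rewrite mulr_ge0// ltW.
have t3 : `|2 * r * k| <= 2 * r * A.
  by rewrite normrM (ger0_norm rr0) ler_wpM2l.
apply: le_trans (ler_pM _ _ t3 t2) _ => //.
have -> : 2 * r * A * (err1 w / (2 * r ^+ 2)) = err1 w * A * r^-1.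
  by field; rewrite gt_eqF.
have -> : err1 w / A = err1 w * A * (A ^+ 2)^-1.
  by field; rewrite gt_eqF.
have e0 : 0 <= err1 w.
  have v0 : 0 <= variation w by rewrite /variation !addr_ge0.
  have lw0 := ltW lw; have l00 := ltW l0; rewrite /err1; apply: mulr_ge0 => //.
  by apply: addr_ge0; apply: divr_ge0 => //; apply: mulr_ge0.
by rewrite ler_wpM2l// mulr_ge0// ltW.
Qed.

(** An error o(1 / A) is what is required, since it is to be integrated over sides of length 2 A. *)
Lemma conn_at_infinity (eta : R) : jacobian M 0 != 0 -> 0 < eta ->
  exists2 A0 : R, 0 < A0 & forall A x y p q, A0 <= A ->
    `|x| <= A -> `|y| <= A -> A ^+ 2 <= sqnorm x y -> `|p| + `|q| <= 1 ->
  `|conn_at_inversion x y p q - conn_main 0 x y p q| <= eta / A.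
Proof.
move=> D0 eta0.
have l0 := lam_gt0 D0.
have sE : smooth fffE by exact: smooth_dot (vsmooth_vd1 sM) (vsmooth_vd1 sM).
have sF : smooth fffF by exact: smooth_dot (vsmooth_vd1 sM) (vsmooth_vd2 sM).
have sG : smooth fffG by exact: smooth_dot (vsmooth_vd2 sM) (vsmooth_vd2 sM).
have sD : smooth (jacobian M).
  exact: smooth_det3 sM (vsmooth_vd1 sM) (vsmooth_vd2 sM).
have cD : jacobian M w @[w --> (0 : R * R)] --> jacobian M 0 by exact: smooth_cont.
have cE : fffE w @[w --> (0 : R * R)] --> fffE 0 by exact: smooth_cont.
have cF : fffF w @[w --> (0 : R * R)] --> fffF 0 by exact: smooth_cont.
have cG : fffG w @[w --> (0 : R * R)] --> fffG 0 by exact: smooth_cont.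
have [E0 G0] := ffE_gt0 D0.
have clam : lam w @[w --> (0 : R * R)] --> lam 0.
  apply: cvgM; first exact: (cvgM cD cD).
  by apply: cvgV; [rewrite gt_eqF// addr_gt0|exact: cvgD].
have clamV : (lam w)^-1 @[w --> (0 : R * R)] --> (lam 0)^-1.
  by apply: cvgV => //; rewrite gt_eqF.
have cnormB (f : R * R -> R) : f w @[w --> (0 : R * R)] --> f 0 ->
    `|f w - f 0| @[w --> (0 : R * R)] --> (0 : R).
  move=> cf; rewrite -(normr0 R) -(subrr (f 0)); apply: cvg_norm.
  by apply: cvgB => //; exact: cvg_cst.
have cvar : variation w @[w --> (0 : R * R)] --> (0 : R).
  rewrite -[0 in X in _ --> X]addr0 -[0 in X in _ --> X + _]addr0.
  by apply: cvgD; [apply: cvgD|]; exact: cnormB.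
have cerr1 : err1 w @[w --> (0 : R * R)] --> (0 : R).
  rewrite [X in _ --> X](_ : 0 = 2 * (0 / lam 0 +
    `|jacobian M 0| * 0 / (lam 0 * lam 0))); last by rewrite !(mulr0, mul0r) addr0 mulr0.
  apply: cvgM; first exact: cvg_cst.
  apply: cvgD; first by apply: cvgM => //; exact: cnormB.
  apply: cvgM; first by apply: cvgM => //; exact: cvg_cst.
  apply: cvgV; first by rewrite gt_eqF// mulr_gt0.
  by apply: cvgM => //; exact: cvg_cst.
have cdet (f g : R * R -> 'I_3 -> R) : vsmooth f -> vsmooth g ->
    `|det3 (M w) (f w) (g w)| @[w --> (0 : R * R)] --> `|det3 (M 0) (f 0) (g 0)|.
  by move=> sf sg; apply: cvg_norm; exact: (smooth_cont (smooth_det3 sM sf sg)).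
have cerr2 : err2 w @[w --> (0 : R * R)] --> err2 0.
  apply: cvgM => //.
  have s1 := vsmooth_vd1 sM; have s2 := vsmooth_vd2 sM.
  have s11 := vsmooth_vd1 s1; have s12 := vsmooth_vd2 s1.
  have s21 := vsmooth_vd1 s2; have s22 := vsmooth_vd2 s2.
  exact: (cvgD (cvgD (cvgD (cvgD (cvgD (cvgD (cvgD (cdet _ _ s1 s11)
    (cdet _ _ s1 s12)) (cdet _ _ s1 s21)) (cdet _ _ s1 s22)) (cdet _ _ s2 s11))
    (cdet _ _ s2 s12)) (cdet _ _ s2 s21)) (cdet _ _ s2 s22)).
have nD : \forall w \near (0 : R * R), jacobian M w != 0.
  exact: (cvgr_neq0 _ cD D0).
have n1 : \forall w \near (0 : R * R), err1 w < eta / 2.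
  by apply: (cerr1 [set r | r < eta / 2]); apply: lt_nbhsl; rewrite divr_gt0.
have n2 : \forall w \near (0 : R * R), err2 w < `|err2 0| + 1.
  by apply: (cerr2 [set r | r < `|err2 0| + 1]); apply: lt_nbhsl; rewrite ltr_pwDr// ler_norm.
have /nbhs_ballP[e /= e0 eP] : \forall w \near (0 : R * R),
    [/\ jacobian M w != 0, err1 w < eta / 2 & err2 w < `|err2 0| + 1].
  by near=> w; split; near: w.
pose C := `|err2 0| + 1.
have C0 : 0 < C by rewrite ltr_pwDr.
(* The first summand sends the boundary of the square into the ball of radius e under inversion, the
   second gives C / A <= eta / 2. *)
exists (2 / e + 2 * C / eta).
  by rewrite addr_gt0// divr_gt0// mulr_gt0.
move=> A x y p q AA xA yA Ar pq1.
have A0 : 0 < A.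
  by apply: lt_le_trans AA; rewrite addr_gt0// divr_gt0// mulr_gt0.
have A2 : 0 < A ^+ 2 by rewrite exprn_gt0.
have n0 : 0 < sqnorm x y by exact: lt_le_trans Ar.
have Ae : A^-1 < e.
  rewrite invf_plt ?posrE//; apply: lt_le_trans AA.
  rewrite -[X in X < _]addr0 ler_ltD//; last by rewrite divr_gt0// mulr_gt0.
  by apply: ler_peMl; [rewrite invr_ge0 ltW|rewrite ler1n].
have AC : C / A <= eta / 2.
  rewrite ler_pdivrMr// mulrC -ler_pdivrMr ?divr_gt0//.
  apply: le_trans AA; rewrite invf_div mulrCA mulrA lerDr divr_ge0// ltW//.
have small (u : R) : `|u| <= A -> `|u / sqnorm x y| < e.
  move=> uA; apply: le_lt_trans Ae.
  rewrite normrM normfV (gtr0_norm n0) ler_pdivrMr// (le_trans uA)//.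
  by rewrite ler_pdivlMl// -expr2.
have [Dw e1 e2] : [/\ jacobian M (inversion x y) != 0,
    err1 (inversion x y) < eta / 2 & err2 (inversion x y) < `|err2 0| + 1].
  by apply: eP; split; rewrite /ball/= sub0r normrN; exact: small.
apply: le_trans (conn_estimate D0 Dw A0 xA yA Ar pq1) _.
rewrite (_ : eta / A = eta / 2 / A + eta / 2 / A); last by field; rewrite gt_eqF.
apply: lerD; first by rewrite ler_pM2r ?invr_gt0// ltW.
apply: (@le_trans _ _ (C / A ^+ 2)).
  by rewrite ler_pM2r ?invr_gt0// ltW.
by rewrite expr2 invfM mulrA ler_pM2r ?invr_gt0.
Unshelve. all: by end_near. Qed.

End ConnectionAtInfinity.

(** * Total curvature *)

Section TotalCurvature.
Context {R : realType}.
Local Notation mu := (@lebesgue_measure R).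

Lemma Rintegral_seg_close (f g : R -> R) (A e : R) : 0 < A ->
  continuous f -> continuous g -> (forall t, `|t| <= A -> `|f t - g t| <= e) ->
  `|\int[mu]_(t in seg A) f t - \int[mu]_(t in seg A) g t| <= 2 * A * e.
Proof.
move=> A0 cf cg fg.
have cB : continuous (fun t => f t - g t).
  by move=> t; apply: cvgB; [exact: cf|exact: cg].
have mA := @measurable_seg R A.
rewrite -RintegralB//; [|exact: seg_integrable..].
apply: le_trans (le_normr_Rintegral _ _) _ => //; first exact: seg_integrable.
apply: (@le_trans _ _ (\int[mu]_(t in seg A) (cst e) t)).
  apply: le_Rintegral => //.
  - by apply: seg_integrable => t; apply: cvg_norm; exact: cB.
  - by apply: seg_integrable; exact: cst_continuous.
  - by move=> t; rewrite segE; exact: fg.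
have muA : mu (seg A) = (2 * A)%:E.
  rewrite /seg lebesgue_measure_itv/= lte_fin gtrN// opprK -EFinD.
  by congr (_%:E); ring.
by rewrite Rintegral_cst// [X in fine X]muA mulrC.
Qed.

(** Intermediate value theorem along the segment from the origin to the point. *)
Lemma constant_sign (j : R * R -> R) : continuous j -> (forall z, j z != 0) ->
  forall z, `|j z| = Num.sg (j 0) * j z.
Proof.
move=> cj j0 [x y].
pose f t := j (t * x, t * y).
have cf : continuous f.
  move=> t; have pc : {for t, continuous (fun t : R => (t * x, t * y))}.
    have dx (u : R) : differentiable (fun t : R => t * u) t.
      apply/derivable1_diffP; exact: (@ex_derive _ _ _ _ _ _ _
        (is_derive_mul (is_derive_id t 1) (is_derive_cst u t 1))).
    by apply/differentiable_continuous/differentiable_pair.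
  exact: (cvg_comp _ _ pc (cj (t * x, t * y))).
have f0 : f 0 = j 0 by rewrite /f !mul0r.
have f1 : f 1 = j (x, y) by rewrite /f !mul1r.
have nIVT : ~~ (Num.min (f 0) (f 1) <= 0 <= Num.max (f 0) (f 1)).
  apply/negP => /(IVT ler01 (continuous_subspaceT cf))[c _ /eqP].
  by apply/negP; exact: j0.
move: nIVT (j0 0) (j0 (x, y)); rewrite f0 f1 ge_min le_max.
move: (j 0) (j (x, y)) => a b.
case: (ltrgt0P a) => // a0; case: (ltrgt0P b) => // b0 _ _ _.
- by rewrite gtr0_sg ?mul1r ?gtr0_norm.
- by rewrite ltr0_sg ?mulN1r ?ltr0_norm.
Qed.

Variables N M : R * R -> 'I_3 -> R.
Hypotheses (sN : vsmooth N) (sM : vsmooth M).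
Hypothesis N1 : forall z, dot (N z) (N z) = 1.
Hypothesis M1 : forall w, dot (M w) (M w) = 1.
Hypothesis NM : forall x y, sqnorm x y != 0 -> N (x, y) = M (inversion x y).
Hypothesis jN : forall z, jacobian N z != 0.
Hypothesis jM : jacobian M 0 != 0.

Let D := jacobian M 0.
Let E := fffE M 0.
Let F := fffF M 0.
Let G := fffG M 0.

(** The boundary integrand of Green's formula, with the four sides folded onto one parameter. *)
Let circ A t : R :=
  conn2 N (A, t) - conn2 N (- A, t) - (conn1 N (t, A) - conn1 N (t, - A)).

Let circ_main A t : R := edge E F G D A t + edge E (- F) G D A t
  + (edge E (- F) G D A t + edge E F G D A t).

(** On each side - z^2 is, up to an overall sign invisible to the quadratic form, (A^2 - t^2, 2 A t)
    or its mirror image (A^2 - t^2, - 2 A t); the mirror image changes the sign of F. *)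
Lemma conn_main_edge A t :
  [/\ conn_main M 0 A t 0 1 = edge E F G D A t,
      conn_main M 0 (- A) t 0 1 = - edge E (- F) G D A t,
      conn_main M 0 t A 1 0 = - edge E (- F) G D A t &
      conn_main M 0 t (- A) 1 0 = edge E F G D A t].
Proof.
rewrite /conn_main /edge -/D -/E -/F -/G -!mulNr /qform /sqnorm.
by split; congr (_ / _); ring.
Qed.

Lemma circ_close (eta : R) : 0 < eta ->
  exists2 A0 : R, 0 < A0 & forall A t, A0 <= A -> `|t| <= A ->
  `|circ A t - circ_main A t| <= 4 * (eta / A).
Proof.
move=> eta0; have [A0 A00 H] := conn_at_infinity sM M1 jM eta0.
exists A0 => // A t AA tA.
have Ap : 0 < A by exact: lt_le_trans AA.
have nA : `|A| <= A by rewrite gtr0_norm.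
have nNA : `|- A| <= A by rewrite normrN.
have t2 : 0 <= t * t by rewrite -expr2 sqr_ge0.
have s1 (B : R) : B * B = A * A -> A ^+ 2 <= sqnorm B t.
  by move=> BA; rewrite /sqnorm BA expr2 lerDl.
have s2 (B : R) : B * B = A * A -> A ^+ 2 <= sqnorm t B.
  by move=> BA; rewrite /sqnorm BA expr2 lerDr.
have AA1 : A * A = A * A by [].
have AA2 : - A * - A = A * A by rewrite mulrNN.
have p1 : `|1 : R| + `|0 : R| <= 1 by rewrite normr1 normr0 addr0.
have p2 : `|0 : R| + `|1 : R| <= 1 by rewrite normr1 normr0 add0r.
have n0 x y : A ^+ 2 <= sqnorm x y -> sqnorm x y != 0.
  by move=> h; rewrite gt_eqF// (lt_le_trans _ h)// exprn_gt0.
have [m1 m2 m3 m4] := conn_main_edge A t.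
have h1 := H A A t 0 1 AA nA tA (s1 _ AA1) p2.
have h2 := H A (- A) t 0 1 AA nNA tA (s1 _ AA2) p2.
have h3 := H A t A 1 0 AA tA nA (s2 _ AA1) p1.
have h4 := H A t (- A) 1 0 AA tA nNA (s2 _ AA2) p1.
rewrite -(conn2_inversion sN sM NM (n0 _ _ (s1 _ AA1))) m1 in h1.
rewrite -(conn2_inversion sN sM NM (n0 _ _ (s1 _ AA2))) m2 in h2.
rewrite -(conn1_inversion sN sM NM (n0 _ _ (s2 _ AA1))) m3 in h3.
rewrite -(conn1_inversion sN sM NM (n0 _ _ (s2 _ AA2))) m4 in h4.
move: h1 h2 h3 h4; rewrite /circ /circ_main.
move: (conn2 N (A, t)) (conn2 N (- A, t)) (conn1 N (t, A)) (conn1 N (t, - A)).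
move: (edge _ _ _ _ _ _) (edge _ _ _ _ _ _) (eta / A) => a b e c1 c2 c3 c4.
rewrite !ler_norml => /andP[? ?] /andP[? ?] /andP[? ?] /andP[? ?].
by apply/andP; split; lra.
Qed.

Lemma continuous_circ A : continuous (circ A).
Proof.
have c1 := smooth_cont (smooth_conn1 sN jN).
have c2 := smooth_cont (smooth_conn2 sN jN).
have c2A B : continuous (fun t => conn2 N (B, t)) by exact: continuous_slice2.
have c1A B : continuous (fun t => conn1 N (t, B)) by exact: continuous_slice1.
by move=> t; apply: cvgB; apply: cvgB; [exact: c2A|exact: c2A|exact: c1A|exact: c1A].
Qed.

Lemma integral_circ_main A : 0 < A ->
  \int[mu]_(t in seg A) circ_main A t = 4 * pi * Num.sg D.
Proof.
move=> A0.
have [E0 G0] := ffE_gt0 sM M1 jM.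
have s0 : 0 < `|D| by rewrite normr_gt0.
have sE : `|D| ^+ 2 = E * G - F ^+ 2.
  by rewrite -normrX ger0_norm ?sqr_ge0// (jacobian_sqr sM M1).
have sE' : `|D| ^+ 2 = E * G - (- F) ^+ 2 by rewrite sqrrN.
have d0 : 0 < E * G - F ^+ 2 by rewrite -sE exprn_gt0.
have d0' : 0 < E * G - (- F) ^+ 2 by rewrite -sE' exprn_gt0.
(* [integral_edge] is stated for a positive area density, so the sign of [D] is pulled out. *)
have sgE F' t : edge E F' G D A t = Num.sg D * edge E F' G `|D| A t.
  by rewrite /edge {1}[D]numEsg; ring.
have ie (F' : R) : 0 < E * G - F' ^+ 2 -> `|D| ^+ 2 = E * G - F' ^+ 2 ->
    \int[mu]_(t in seg A) edge E F' G D A t = Num.sg D * pi.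
  move=> dF' sF'; under eq_Rintegral do rewrite sgE.
  rewrite RintegralZl ?(integral_edge E0 s0 sF' A0)//; first exact: measurable_seg.
  by apply: seg_integrable; exact: continuous_edge.
have ci (F' : R) : 0 < E * G - F' ^+ 2 -> continuous (edge E F' G D A).
  by move=> dF'; exact: continuous_edge.
have cs : continuous (fun t => edge E F G D A t + edge E (- F) G D A t).
  by move=> t; apply: cvgD; exact: ci.
have cs' : continuous (fun t => edge E (- F) G D A t + edge E F G D A t).
  by move=> t; apply: cvgD; exact: ci.
have mA := @measurable_seg R A.
rewrite /circ_main RintegralD//; [|exact: seg_integrable..].
rewrite !RintegralD//; try by apply: seg_integrable; exact: ci.
rewrite !ie//; ring.
Qed.

Lemma integral_jacobian_square (eta : R) : 0 < eta ->
  exists2 A0 : R, 0 < A0 & forall A, A0 <= A -> exists2 v : R,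
    (\int[mu \x mu]_(z in square A) (`|jacobian N z|)%:E = v%:E)%E &
    `|v - 4 * pi| <= 8 * eta.
Proof.
move=> eta0; have [A0 A00 H] := circ_close eta0.
exists A0 => // A AA; have Ap : 0 < A by exact: lt_le_trans AA.
have c1 := smooth_cont (smooth_conn1 sN jN).
have c2 := smooth_cont (smooth_conn2 sN jN).
have cj : continuous (jacobian N).
  exact: smooth_cont (smooth_det3 sN (vsmooth_vd1 sN) (vsmooth_vd2 sN)).
have mA := @measurable_seg R A.
pose v := \int[mu]_(t in seg A) circ A t.
have cB2 : continuous (fun t => conn2 N (A, t) - conn2 N (- A, t)).
  by move=> t; apply: cvgB; exact: continuous_slice2.
have cB1 : continuous (fun t => conn1 N (t, A) - conn1 N (t, - A)).
  by move=> t; apply: cvgB; exact: continuous_slice1.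
have Gr := Green_square Ap (smooth_conn1 sN jN) (smooth_conn2 sN jN).
rewrite -RintegralB// -/v in Gr; [|exact: seg_integrable..].
have {}Gr : (\int[mu \x mu]_(z in square A) (- jacobian N z)%:E = v%:E)%E.
  by rewrite -Gr; apply: eq_integral => z _; rewrite (curl_conn sN N1 jN).
have sgj := constant_sign cj jN.
set sg := Num.sg (jacobian N 0) in sgj.
have absE : (\int[mu \x mu]_(z in square A) (`|jacobian N z|)%:E =
    (- sg * v)%:E)%E.
  transitivity (\int[mu \x mu]_(z in square A)
      ((- sg)%:E * (- jacobian N z)%:E))%E.
    by apply: eq_integral => z _; rewrite sgj -EFinM mulrNN.
  rewrite integralZl//; first by rewrite Gr EFinM.
    exact: measurable_square.
  by apply: square_integrable => z; apply: cvgN; exact: cj.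
exists (- sg * v) => //.
have v0 : 0 <= - sg * v.
  rewrite -lee_fin -absE; apply: integral_ge0 => z _.
  by rewrite lee_fin normr_ge0.
have vclose : `|v - 4 * pi * Num.sg D| <= 8 * eta.
  rewrite -(integral_circ_main Ap).
  have := Rintegral_seg_close Ap (@continuous_circ A) _ (fun t => H A t AA).
  rewrite -/v (_ : 2 * A * _ = 8 * eta); last by field; rewrite gt_eqF.
  apply; have [E0 G0] := ffE_gt0 sM M1 jM.
  have d0 : 0 < E * G - F ^+ 2 by rewrite -(jacobian_sqr sM M1) exprn_even_gt0.
  have d0' : 0 < E * G - (- F) ^+ 2 by rewrite sqrrN.
  by move=> t; apply: cvgD; apply: cvgD; exact: continuous_edge.
(* [v] is close to 4 pi times the sign of [D], while [- sg * v] is nonnegative. Passing to absolute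
   values avoids comparing the orientations of the two charts. *)
have absv : - sg * v = `|v|.
  rewrite -[LHS]ger0_norm// normrM normrN /sg normr_sg jN mul1r//.
have absD : `|4 * pi * Num.sg D| = 4 * pi.
  by rewrite normrM normr_sg jM mulr1 ger0_norm// mulr_ge0// pi_ge0.
by rewrite absv -absD; apply: le_trans (ler_dist_dist _ _) vclose.
Qed.

Theorem total_curvature :
  (\int[mu \x mu]_z (`|jacobian N z|)%:E = (4 * pi)%:E)%E.
Proof.
have cj : continuous (fun z => `|jacobian N z|).
  move=> z; apply: cvg_norm.
  exact: (smooth_cont (smooth_det3 sN (vsmooth_vd1 sN) (vsmooth_vd2 sN))).
have c1 := cvg_integral_square cj (fun z => normr_ge0 _).
apply: cvg_unique c1 _ => //.
pose v n := fine (\int[mu \x mu]_(z in square n%:R) (`|jacobian N z|)%:E)%E.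
have fin n : (\int[mu \x mu]_(z in square n%:R) (`|jacobian N z|)%:E =
    (v n)%:E)%E.
  rewrite /v fineK//; apply: integrable_fin_num; first exact: measurable_square.
  exact: square_integrable.
rewrite (_ : (fun n => _) = fun n => (v n)%:E); last exact/funext.
apply: cvg_EFin; first exact: nearW.
apply/cvgrPdist_le => e e0.
have e8 : 0 < e / 8 by rewrite divr_gt0.
have [A0 A00 H] := integral_jacobian_square e8.
near=> n.
have An : A0 <= n%:R by near: n; exact: nbhs_infty_ger.
have [w wE we] := H _ An.
move: we; have -> : w = v n by apply: EFin_inj; rewrite -wE fin.
by rewrite distrC /= (_ : 8 * (e / 8) = e)//; field.
Unshelve. all: by end_near. Qed.

End TotalCurvature.

(** * The light cone seen by the observer [u], and the charts of the sphere *)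

Section LorentzFrame.
Context {R : realType}.
Implicit Types (x y u : 'rV[R]_4) (a b : 'I_3 -> R).

Definition spatial x (i : 'I_3) : R := x ord0 (lift ord0 i).

Lemma sum_ord3 (f : 'I_3 -> R) : \sum_(i < 3) f i = f 0 + f 1 + f 2.
Proof.
rewrite !big_ord_recl big_ord0 addr0 addrA.
by congr (_ + _ + _); congr f; exact/val_inj.
Qed.

Lemma lorentzE x y :
  lorentz x y = - (x ord0 ord0 * y ord0 ord0) + dot (spatial x) (spatial y).
Proof. by rewrite /lorentz sum_ord3. Qed.

Lemma lorentzC x y : lorentz x y = lorentz y x.
Proof. by rewrite !lorentzE dotC [y _ _ * _]mulrC. Qed.

(** Supplies the product with [y] as a packaged continuous linear form, so that smoothness and
    differentials pass through it. *)
Lemma lorentz_linear_form y : exists2 L : {linear 'rV[R]_4 -> R},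
  continuous L & forall x, L x = lorentz x y.
Proof.
have lin : linear (fun x => lorentz x y).
  by move=> c x z; rewrite !lorentzE /dot /spatial !mxE /GRing.scale/=; ring.
pose linM := GRing.isLinear.Build _ _ _ _ _ lin.
pose L : {linear 'rV[R]_4 -> R} := HB.pack (fun x => lorentz x y) linM.
exists L => // x; rewrite /L/=.
have ck (k : 'I_4) (c : R) : {for x, continuous (fun x => x ord0 k * c)}.
  have cc : {for x, continuous (fun x : 'rV[R]_4 => x ord0 k)}.
    exact: coord_continuous.
  exact: (cvgM cc (cvg_cst c)).
rewrite (_ : (fun x => _) = fun x => - (x ord0 ord0 * y ord0 ord0) +
  (x ord0 (lift ord0 0) * y ord0 (lift ord0 0)
  + x ord0 (lift ord0 1) * y ord0 (lift ord0 1)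
  + x ord0 (lift ord0 2) * y ord0 (lift ord0 2))); last first.
  by apply/funext => z; rewrite lorentzE.
exact: (cvgD (cvgN (ck _ _)) (cvgD (cvgD (ck _ _) (ck _ _)) (ck _ _))).
Qed.

Lemma lorentz_eq0 x : (forall y, lorentz x y = 0) -> x = 0.
Proof.
(* Reversing the time coordinate turns the product into the Euclidean square norm of [x]. *)
move=> x0; pose y : 'rV[R]_4 :=
  \row_k (if k == ord0 then - x ord0 ord0 else x ord0 k).
have := x0 y; rewrite lorentzE (_ : spatial y = spatial x); last first.
  by apply/funext => i; rewrite /spatial mxE.
rewrite mxE eqxx mulrN opprK => /eqP.
rewrite paddr_eq0 ?dot_ge0// -?expr2 ?sqr_ge0// sqrf_eq0.
move=> /andP[/eqP x00 /eqP /dot_eq0 xs].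
apply/rowP => k; rewrite mxE; case: (unliftP ord0 k) => [j ->|->] //.
exact: xs.
Qed.

(** Lagrange's identity: the difference is the square norm of the cross product. *)
Lemma Cauchy_dot a b : dot a b ^+ 2 <= dot a a * dot b b.
Proof.
rewrite -subr_ge0 (_ : _ - _ = (a 0 * b 1 - a 1 * b 0) ^+ 2 +
  (a 0 * b 2 - a 2 * b 0) ^+ 2 + (a 1 * b 2 - a 2 * b 1) ^+ 2).
  by rewrite !addr_ge0// sqr_ge0.
rewrite /dot; ring.
Qed.

(* The images of the spatial basis vectors under the boost taking
   [(-1, 0, 0, 0)] to [u]. *)
Definition frame u (i : 'I_3) : 'rV[R]_4 :=
  \row_k (if unlift ord0 k is Some j
          then (i == j)%:R + spatial u i * spatial u j / (1 - u ord0 ord0)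
          else - spatial u i).

Lemma lorentz_frame u x i : lorentz x (frame u i) =
  spatial x i + spatial u i *
    (x ord0 ord0 + dot (spatial u) (spatial x) / (1 - u ord0 ord0)).
Proof.
rewrite lorentzE.
have -> : frame u i ord0 ord0 = - spatial u i by rewrite mxE unlift_none.
have -> : spatial (frame u i) = fun j =>
    (i == j)%:R + spatial u i * spatial u j / (1 - u ord0 ord0).
  by apply/funext => j; rewrite {1}/spatial mxE liftK.
move: (spatial u) (spatial x) (u ord0 ord0) (x ord0 ord0) => a b c d.
move: (1 - c)^-1 => k.
by move: i; apply: forall_ord3; rewrite /dot /=; ring.
Qed.

Section Observer.
Variable u : 'rV[R]_4.
Hypotheses (u_unit : lorentz u u = -1) (u_past : u ord0 ord0 < 0).

Definition components x i : R := lorentz x (frame u i).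

(** Together with [u], the vectors [frame u i] form a Lorentz-orthonormal basis in which [u] is
    timelike. The expansion is checked in coordinates from |spatial u|^2 = u_0^2 - 1. *)
Lemma Parseval x y :
  lorentz x y = - (lorentz x u * lorentz y u) + dot (components x) (components y).
Proof.
have uu : dot (spatial u) (spatial u) = u ord0 ord0 ^+ 2 - 1.
  by move: u_unit; rewrite lorentzE expr2 => <-; ring.
have k0 : 1 - u ord0 ord0 != 0 by rewrite gt_eqF// subr_gt0 (lt_trans u_past).
have -> : dot (components x) (components y) =
  let k := (1 - u ord0 ord0)^-1 in
  let r := dot (spatial u) (spatial x) in let s := dot (spatial u) (spatial y) in
  dot (spatial x) (spatial y) + r * (y ord0 ord0 + s * k)
  + s * (x ord0 ord0 + r * k)
  + dot (spatial u) (spatial u) * (x ord0 ord0 + r * k) * (y ord0 ord0 + s * k).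
  rewrite /= {1}/dot /components !lorentz_frame.
  move: (_ + dot _ _ / _) (_ + dot _ _ / _) => p q; rewrite /dot; ring.
rewrite /= uu !lorentzE (dotC (spatial x) (spatial u)) (dotC (spatial y) (spatial u)).
move: (dot _ _) (dot _ _) (dot _ _) => r s t.
by field.
Qed.

Lemma components_eq0 x : lorentz x u = 0 -> (forall i, components x i = 0) -> x = 0.
Proof.
move=> xu xc; apply: lorentz_eq0 => y.
by rewrite Parseval xu /dot !xc !mul0r oppr0 !add0r.
Qed.

(** By Cauchy-Schwarz the spatial product d satisfies d^2 <= x_0^2 (u_0^2 - 1) < (x_0 u_0)^2. As x_0
    u_0 < 0, a nonpositive height, that is d <= x_0 u_0, would contradict this. *)
Lemma lightcone_height_gt0 x : future_lightcone x -> 0 < lorentz x u.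
Proof.
move=> [xx x0].
have uu : dot (spatial u) (spatial u) = u ord0 ord0 ^+ 2 - 1.
  by move: u_unit; rewrite lorentzE expr2 => <-; ring.
have xxs : dot (spatial x) (spatial x) = x ord0 ord0 ^+ 2.
  by move: xx; rewrite lorentzE expr2 => /eqP; rewrite addrC subr_eq0 => /eqP.
have := Cauchy_dot (spatial x) (spatial u); rewrite uu xxs lorentzE.
move: (x ord0 ord0) (u ord0 ord0) (dot _ _) x0 u_past => a c d a0 c0 h.
rewrite ltNge; apply/negP => dle.
have ac : 0 < - (a * c) by rewrite -mulrN mulr_gt0// oppr_gt0.
have h1 : (- (a * c)) ^+ 2 <= (- d) ^+ 2.
  by apply: lerXn2r; rewrite ?nnegrE ?(ltW ac)//; lra.
have h2 : 0 < a ^+ 2 by rewrite exprn_gt0.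
move: h1 h; rewrite !sqrrN exprMn mulrBr mulr1 => h1 h; lra.
Qed.

End Observer.
End LorentzFrame.

Section SphereCharts.
Context {R : realType}.

Lemma chart_inversion (b : bool) (x y : R) : sqnorm x y != 0 ->
  chart (~~ b) (inversion x y) = chart b (x, y).
Proof.
move=> n0; apply: val_inj; rewrite /= /stereo_coord/=.
have m0 : sqnorm x y + 1 != 0.
  by rewrite gt_eqF// ltr_wpDl// /sqnorm addr_ge0// -expr2 sqr_ge0.
move: n0 m0; rewrite /sqnorm => n0 m0.
have k0 : x ^+ 2 + y ^+ 2 + (x * x + y * y) ^+ 2 != 0.
  rewrite (_ : _ + _ = (x * x + y * y) * (x * x + y * y + 1)) ?mulf_neq0//; ring.
apply/rowP => i; rewrite !mxE.
move: i; apply: forall_ord3; rewrite /=; case: b; rewrite /= ?expr0 ?expr1; field.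
all: by rewrite n0 m0 k0.
Qed.

(** Each closed hemisphere, projected from the opposite pole, lands in the unit disc. Two compact
    squares thus cover the sphere, and compactness arguments can be run in the charts. *)
Lemma chart_surj (p : sphere2 R) : exists b, exists2 z, square 1 z & p = chart b z.
Proof.
case: p => v vS; have := vS; rewrite inE /sphere2 /= sum_ord3 => v1.
have h0 := sqr_ge0 (v ord0 0); have h1 := sqr_ge0 (v ord0 1).
have le1 (a c : R) : 0 <= c -> a ^+ 2 <= (1 + c) * (1 + c) -> `|a / (1 + c)| <= 1.
  move=> c0 ac; have c1 : 0 < 1 + c by rewrite ltr_wpDr.
  rewrite normrM normfV (gtr0_norm c1) ler_pdivrMr// mul1r.
  by rewrite -ler_sqr ?nnegrE ?(ltW c1)// real_normK ?num_real// [(1 + c) ^+ 2]expr2.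
pose b := 0 <= v ord0 2.
pose c := `|v ord0 2|.
have c0 : 0 <= c by exact: normr_ge0.
have cE : v ord0 2 = (-1) ^+ b * - c.
  rewrite /b /c; case: (lerP 0 (v ord0 2)) => h.
    by rewrite expr1 mulN1r opprK ger0_norm.
  by rewrite expr0 mul1r ltr0_norm// opprK.
have vc : v ord0 0 ^+ 2 + v ord0 1 ^+ 2 + c ^+ 2 = 1.
  by rewrite -v1 cE exprMn sqrrN sqrr_sign mul1r.
have c2 := sqr_ge0 c.
exists b, (v ord0 0 / (1 + c), v ord0 1 / (1 + c)).
  by split; rewrite segE /=; apply: le1 => //; rewrite expr2 in c2 vc |- *; lra.
apply: val_inj; rewrite /= /stereo_coord/=.
have c1 : 1 + c != 0 by rewrite gt_eqF// ltr_wpDr.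
have nE : (v ord0 0 / (1 + c)) ^+ 2 + (v ord0 1 / (1 + c)) ^+ 2 = (1 - c) / (1 + c).
  rewrite !expr_div_n -mulrDl (_ : v ord0 0 ^+ 2 + _ = (1 - c) * (1 + c)).
    by field.
  by rewrite -[LHS](addrK (c ^+ 2)) vc; ring.
have n1 : (1 - c) / (1 + c) + 1 = 2 / (1 + c) by field.
have n2 : (1 - c) / (1 + c) - 1 = - 2 * c / (1 + c) by field.
apply/rowP => i; rewrite mxE nE n1 n2.
move: i; apply: forall_ord3 => /=.
- by field.
- by field.
- by rewrite cE; field.
Qed.

Lemma sphere_EVT (k : sphere2 R -> R) : (forall b, continuous (k \o chart b)) ->
  exists b z, forall q, k q <= k (chart b z).
Proof.
move=> ck.
have maxb b : exists2 z, square 1 z & forall w, square 1 w -> k (chart b w) <= k (chart b z).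
  have cb : {within square 1, continuous (k \o chart b)} by exact/continuous_subspaceT/ck.
  have [||z /set_mem zS zM] := @compact_EVT_max _ _ (k \o chart b) (square 1) _ _ cb.
  - by exists (0, 0); split; rewrite segE normr0.
  - exact: compact_square.
  - by exists z => // w /mem_set; exact: zM.
have [z0 _ m0] := maxb false; have [z1 _ m1] := maxb true.
case: (lerP (k (chart false z0)) (k (chart true z1))) => h.
  exists true, z1 => q; have [[] [z zS ->]] := chart_surj q; first exact: m1.
  exact: le_trans (m0 _ zS) h.
exists false, z0 => q; have [[] [z zS ->]] := chart_surj q; last exact: m0.
exact: le_trans (m1 _ zS) (ltW h).
Qed.

End SphereCharts.

(** * The normal projection of a surface in the light cone *)

Section Differentials.
Context {R : realType}.

Lemma smooth_lorentz (P : R * R -> 'rV[R]_4) y : smooth P ->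
  smooth (fun z => lorentz (P z) y) /\
  forall z v, 'd (fun z => lorentz (P z) y) z v = lorentz ('d P z v) y.
Proof.
move=> sP; have [L cL LE] := lorentz_linear_form y.
have -> : (fun z => lorentz (P z) y) = L \o P by apply/funext => z; rewrite /= LE.
split=> [k|z v]; first exact: Ck_linear_comp (sP k).
have dP : differentiable P z by have [] := sP 1.
have dL : differentiable L (P z) by exact: linear_differentiable.
by rewrite diff_comp//= diff_lin// LE.
Qed.

Lemma det_mx2 (A : 'M[R]_2) :
  \det A = A ord0 ord0 * A 1 1 - A ord0 1 * A 1 ord0.
Proof.
rewrite (expand_det_row _ ord0) !big_ord_recl big_ord0 addr0 /cofactor !det_mx11.
rewrite !mxE /= expr0 mul1r expr1 mulN1r mulrN.
by congr (_ * _ - _ * _); congr (A _ _); exact/val_inj.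
Qed.

Lemma derive_at_max (f : R -> R) (x d : R) : (forall t, derivable f t 1) ->
  is_derive x 1 f d -> (forall t, f t <= f x) -> d = 0.
Proof.
move=> fd dx fx; apply: is_derive_unique dx _.
apply: (@derive1_at_max _ f (x - 1) (x + 1)) => //.
- by rewrite lerD2l; lra.
- by rewrite in_itv/=; apply/andP; split; lra.
Qed.

Lemma det3_orthogonal (n v w y : 'I_3 -> R) : det3 n v w != 0 ->
  dot y n = 0 -> dot y v = 0 -> dot y w = 0 -> forall i, y i = 0.
Proof.
move=> D0 yn yv yw.
have cramer : forall i, det3 n v w * y i = 0.
  apply: forall_ord3.
  - transitivity (dot y n * (v 1 * w 2 - v 2 * w 1) - dot y v * (n 1 * w 2 - n 2 * w 1)
      + dot y w * (n 1 * v 2 - n 2 * v 1)); first by rewrite /det3 /dot; ring.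
    by rewrite yn yv yw; ring.
  - transitivity (- dot y n * (v 0 * w 2 - v 2 * w 0) + dot y v * (n 0 * w 2 - n 2 * w 0)
      - dot y w * (n 0 * v 2 - n 2 * v 0)); first by rewrite /det3 /dot; ring.
    by rewrite yn yv yw; ring.
  - transitivity (dot y n * (v 0 * w 1 - v 1 * w 0) - dot y v * (n 0 * w 1 - n 1 * w 0)
      + dot y w * (n 0 * v 1 - n 1 * v 0)); first by rewrite /det3 /dot; ring.
    by rewrite yn yv yw; ring.
by move=> i; have /eqP := cramer i; rewrite mulf_eq0 (negbTE D0) => /eqP.
Qed.

End Differentials.

Section NormalMap.
Context {R : realType}.
Variable psi : sphere2 R -> 'rV[R]_4.
Hypotheses (psi_immersion : immersion psi) (psi_spacelike : spacelike psi)
  (psi_lightcone : range psi `<=` future_lightcone).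
Variable u : 'rV[R]_4.
Hypotheses (u_unit : lorentz u u = -1) (u_past : u ord0 ord0 < 0).

Definition height (p : sphere2 R) : R := lorentz (psi p) u.

(* [psi p = height p * (nu p - u)]: [nu] is the projection of [psi] from the
   light cone to the unit sphere of [u^perp]. *)
Definition nu (p : sphere2 R) i : R := components u (psi p) i / height p.

Definition height_chart b z := height (chart b z).
Definition nu_chart b z := nu (chart b z).

Lemma height_gt0 p : 0 < height p.
Proof. by apply: lightcone_height_gt0 => //; apply: psi_lightcone; exists p. Qed.

Lemma height_neq0 p : height p != 0.
Proof. by rewrite gt_eqF// height_gt0. Qed.

Lemma components_nu p i : components u (psi p) i = height p * nu p i.
Proof. by rewrite /nu mulrC divfK// height_neq0. Qed.

(** Nullity of [psi p] and [Parseval] equate the squares of the height and of the norm of the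
    spatial components. *)
Lemma dot_nu p : dot (nu p) (nu p) = 1.
Proof.
have [pp _] : future_lightcone (psi p) by apply: psi_lightcone; exists p.
move: pp; rewrite (Parseval u_unit u_past) => /eqP; rewrite addrC subr_eq0 => /eqP.
have -> : dot (components u (psi p)) (components u (psi p)) =
    height p ^+ 2 * dot (nu p) (nu p) by rewrite /dot !components_nu; ring.
rewrite -/(height p) -expr2 -[X in _ = X]mulr1.
by apply: mulfI; rewrite expf_neq0// height_neq0.
Qed.

Lemma smooth_chart_psi b : smooth (psi \o chart b).
Proof. by case: psi_immersion. Qed.

Lemma smooth_height b : smooth (height_chart b).
Proof. by have [] := smooth_lorentz u (smooth_chart_psi b). Qed.

Lemma smooth_nu b : vsmooth (nu_chart b).
Proof.
move=> i; apply: smooth_div; last exact: smooth_height.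
  by move=> z; exact: height_neq0.
by have [] := smooth_lorentz (frame u i) (smooth_chart_psi b).
Qed.

Lemma dot_nu_chart b z : dot (nu_chart b z) (nu_chart b z) = 1.
Proof. exact: dot_nu. Qed.

Lemma nu_chart_inversion b x y : sqnorm x y != 0 ->
  nu_chart b (x, y) = nu_chart (~~ b) (inversion x y).
Proof. by move=> n0; rewrite /nu_chart chart_inversion. Qed.

Definition dnu b (z v : R * R) i : R :=
  v.1 * vd1 (nu_chart b) z i + v.2 * vd2 (nu_chart b) z i.

Lemma dot_nu_dnu b z v : dot (nu_chart b z) (dnu b z v) = 0.
Proof.
have h1 := dot_vd1 (smooth_nu b) (dot_nu_chart b) z.
have h2 := dot_vd2 (smooth_nu b) (dot_nu_chart b) z.
transitivity (v.1 * dot (nu_chart b z) (vd1 (nu_chart b) z)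
  + v.2 * dot (nu_chart b z) (vd2 (nu_chart b) z)).
  by rewrite /dot /dnu; ring.
by rewrite h1 h2 !mulr0 addr0.
Qed.

(** The spatial part of d psi is h d nu + (dh) nu and its part along [u] is governed by dh. Since
    [nu] is a unit vector orthogonal to d nu, the two dh contributions cancel. *)
Lemma induced_metricE b z v w :
  induced_metric psi b z v w = height_chart b z ^+ 2 * dot (dnu b z v) (dnu b z w).
Proof.
have sP := smooth_chart_psi b; have sh := smooth_height b.
have [_ dh] := smooth_lorentz u sP.
have dc t i : components u ('d (psi \o chart b) z t) i =
    height_chart b z * dnu b z t i + 'd (height_chart b) z t * nu_chart b z i.
  have [_ dF] := smooth_lorentz (frame u i) sP.
  rewrite /components -dF.
  have -> : (fun z => lorentz ((psi \o chart b) z) (frame u i)) =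
      height_chart b * (fun z => nu_chart b z i).
    by apply/funext => s; exact: components_nu.
  have dnui : differentiable (fun z => nu_chart b z i) z.
    exact: smooth_diff (smooth_nu b i).
  have -> : 'd (height_chart b * (fun z => nu_chart b z i)) z t =
      height_chart b z * 'd (fun z => nu_chart b z i) z t
      + nu_chart b z i * 'd (height_chart b) z t.
    by rewrite (diffM (smooth_diff z sh) dnui).
  rewrite [nu_chart b z i * _]mulrC; congr (_ * _ + _).
  exact: diff_pd.
have dcf t : components u ('d (psi \o chart b) z t) = fun i =>
    height_chart b z * dnu b z t i + 'd (height_chart b) z t * nu_chart b z i.
  exact/funext.
rewrite /induced_metric (Parseval u_unit u_past) -!dh -/(height_chart b).
have := dot_nu_chart b z; have := dot_nu_dnu b z v; have := dot_nu_dnu b z w.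
rewrite !dcf.
move: ('d (height_chart b) z v) ('d (height_chart b) z w) => s t.
move: (height_chart b z) (nu_chart b z) (dnu b z v) (dnu b z w) => h n p q nq np nn.
transitivity (h ^+ 2 * dot p q + h * t * dot n p + h * s * dot n q
  + s * t * (dot n n - 1)); first by rewrite /dot; ring.
by rewrite nq np nn; ring.
Qed.

Lemma dnu10 b z : dnu b z (1, 0) = vd1 (nu_chart b) z.
Proof. by apply/funext => i; rewrite /dnu/= mul1r mul0r addr0. Qed.

Lemma dnu01 b z : dnu b z (0, 1) = vd2 (nu_chart b) z.
Proof. by apply/funext => i; rewrite /dnu/= mul1r mul0r add0r. Qed.

Lemma jacobian_nu_neq0 b z : jacobian (nu_chart b) z != 0.
Proof.
have jsq := jacobian_sqr (smooth_nu b) (dot_nu_chart b) z.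
have h2 : 0 < height_chart b z ^+ 2 by rewrite exprn_gt0// height_gt0.
have E0 : 0 < fffE (nu_chart b) z.
  have : 0 < induced_metric psi b z (1, 0) (1, 0).
    apply: psi_spacelike; apply/eqP => -[/eqP]; apply/negP; exact: oner_neq0.
  by rewrite induced_metricE dnu10 pmulr_rgt0.
(* The vector (F, - E) is orthogonal to (1, 0) for the pulled back metric and has square length E (E
   G - F^2) = E J^2. *)
pose v : R * R := (fffF (nu_chart b) z, - fffE (nu_chart b) z).
have : 0 < induced_metric psi b z v v.
  apply: psi_spacelike; apply/eqP => -[_ /eqP].
  by rewrite oppr_eq0 gt_eqF.
rewrite induced_metricE pmulr_rgt0//.
have -> : dot (dnu b z v) (dnu b z v) =
    fffE (nu_chart b) z * jacobian (nu_chart b) z ^+ 2.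
  rewrite jsq /dnu dot_comb /= -/(fffE _ z) -/(fffF _ z) -/(fffG _ z); ring.
by apply: contraTneq => ->; rewrite expr0n mulr0 ltxx.
Qed.

Lemma area_elementE b z :
  area_element psi b z = height_chart b z ^+ 2 * `|jacobian (nu_chart b) z|.
Proof.
rewrite /area_element det_mx2 !mxE /= !induced_metricE dnu10 dnu01.
rewrite [dot (vd2 _ _) (vd1 _ _)]dotC.
have jsq := jacobian_sqr (smooth_nu b) (dot_nu_chart b) z.
rewrite (_ : _ - _ = (height_chart b z ^+ 2 * jacobian (nu_chart b) z) ^+ 2).
  by rewrite sqrtr_sqr normrM ger0_norm// sqr_ge0.
by rewrite [RHS]exprMn jsq /fffE /fffF /fffG; ring.
Qed.

Lemma integral_jacobian_nu :
  (\int[@lebesgue_measure R \x @lebesgue_measure R]_z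
     (`|jacobian (nu_chart false) z|)%:E = (4 * pi)%:E)%E.
Proof.
apply: (@total_curvature _ (nu_chart false) (nu_chart true)).
- exact: smooth_nu.
- exact: smooth_nu.
- exact: dot_nu_chart.
- exact: dot_nu_chart.
- exact: nu_chart_inversion.
- exact: jacobian_nu_neq0.
- exact: jacobian_nu_neq0.
Qed.

(* At a maximum of [<a, nu>] the vector [a] is normal, i.e. [a = nu] or
   [a = - nu]; in the second case [nu] would be constant. *)
Lemma nu_surj (a : 'I_3 -> R) : dot a a = 1 -> exists p, nu p = a.
Proof.
move=> a1.
have dk (f : R -> 'I_3 -> R) (t : R) d : is_vderive f t d ->
    is_derive t 1 (fun s => dot a (f s)) (dot a d).
  move=> fd; have := @is_derive_dot _ (fun=> a) f t (fun=> 0) d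
    (fun i => is_derive_cst (a i) t 1) fd.
  by move/is_derive_eq; apply; rewrite /dot; ring.
have sk b : smooth (fun z => dot a (nu_chart b z)).
  by apply: smooth_dot (smooth_nu b) => i k; exact: Ck_cst.
have [b [[x y] maxk]] := @sphere_EVT _ (fun p => dot a (nu p))
  (fun b => smooth_cont (sk b)).
set n := nu (chart b (x, y)) in maxk.
have av : dot a (vd1 (nu_chart b) (x, y)) = 0.
  apply: (@derive_at_max _ (fun s => dot a (nu_chart b (s, y))) x).
  - move=> t; exact: (@ex_derive _ _ _ _ _ _ _
      (dk _ _ _ (is_vderive_vd1 t y (smooth_nu b)))).
  - exact: dk (is_vderive_vd1 x y (smooth_nu b)).
  - by move=> t; exact: maxk.
have aw : dot a (vd2 (nu_chart b) (x, y)) = 0.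
  apply: (@derive_at_max _ (fun s => dot a (nu_chart b (x, s))) y).
  - move=> t; exact: (@ex_derive _ _ _ _ _ _ _
      (dk _ _ _ (is_vderive_vd2 x t (smooth_nu b)))).
  - exact: dk (is_vderive_vd2 x y (smooth_nu b)).
  - by move=> t; exact: maxk.
have nv := dot_vd1 (smooth_nu b) (dot_nu_chart b) (x, y).
have nw := dot_vd2 (smooth_nu b) (dot_nu_chart b) (x, y).
have nn : dot n n = 1 by exact: dot_nu.
rewrite -[nu_chart b (x, y)]/n in nv nw.
pose t := dot a n.
have an i : a i - t * n i = 0.
  have dl c : dot (fun i => a i - t * n i) c = dot a c - t * dot n c.
    by rewrite /dot; ring.
  apply: (@det3_orthogonal _ _ _ _ (fun i => a i - t * n i)
    (jacobian_nu_neq0 b (x, y)) _ _ _ i).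
  - by rewrite dl -/n -/t -[nu_chart b (x, y)]/n nn mulr1 subrr.
  - by rewrite dl av nv mulr0 subr0.
  - by rewrite dl aw nw mulr0 subr0.
have {}an i : a i = t * n i by apply/eqP; rewrite -subr_eq0 an.
have t2 : t ^+ 2 = 1.
  rewrite -a1 (_ : dot a a = t ^+ 2 * dot n n); first by rewrite nn mulr1.
  by rewrite {1}/dot !an /dot; ring.
have [t1|tN1] : t = 1 \/ t = -1.
  by move/eqP: t2; rewrite sqrf_eq1 => /orP[] /eqP; [left|right].
  exists (chart b (x, y)); apply/funext => i; rewrite an t1 mul1r//.
exfalso.
(* The maximum of <a, nu> being - 1, |nu q + a|^2 = 2 + 2 <a, nu q> is nonpositive for every [q]. *)
have nuN q i : nu q i + a i = 0.
  apply: (@dot_eq0 _ (fun i => nu q i + a i)).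
  apply/eqP; rewrite eq_le dot_ge0 andbT.
  have -> : dot (fun i => nu q i + a i) (fun i => nu q i + a i) =
    dot (nu q) (nu q) + dot a a + 2 * dot a (nu q) by rewrite /dot; ring.
  have := maxk q; rewrite -/n -/t tN1 dot_nu a1 => h; lra.
have v0 i : vd1 (nu_chart b) (x, y) i = 0.
  have := is_vderive_vd1 x y (smooth_nu b) i.
  rewrite (_ : (fun s => _) = cst (- a i)).
    by move=> h; rewrite -(is_derive_unique (is_derive_cst (- a i : R) x 1) h).
  by apply/funext => s; apply/eqP; rewrite -addr_eq0 nuN.
by have := jacobian_nu_neq0 b (x, y); rewrite /jacobian det3_0// eqxx.
Qed.

(** For [x] in the target sphere, its spatial components over [r] form a unit vector, attained by
    [nu] at some [p]. Then [psi p] and [x] agree in height and in spatial components. *)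
Lemma range_of_constant_height r : (forall p, height p = r) ->
  range psi = lightcone_sphere u r.
Proof.
move=> hr; apply/seteqP; split => [_ [p _ <-]|x [xx ux]].
  have [pp _] : future_lightcone (psi p) by apply: psi_lightcone; exists p.
  by split => //; rewrite lorentzC; exact: hr.
have r0 : r != 0 by rewrite -(hr (chart false 0)) height_neq0.
have xu : lorentz x u = r by rewrite lorentzC.
have cx : dot (components u x) (components u x) = r ^+ 2.
  move: xx; rewrite (Parseval u_unit u_past) xu -expr2 => /eqP.
  by rewrite addrC subr_eq0 => /eqP.
have [p pE] : exists p, nu p = fun i => components u x i / r.
  apply: nu_surj; transitivity (dot (components u x) (components u x) / r ^+ 2).
    by rewrite /dot; field.
  by rewrite cx divff// expf_neq0.
exists p => //; apply/eqP; rewrite -subr_eq0; apply/eqP.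
have subl y : lorentz (psi p - x) y = lorentz (psi p) y - lorentz x y.
  by rewrite !lorentzE /dot /spatial !mxE; ring.
apply: (components_eq0 u_unit u_past).
  by rewrite subl xu -/(height p) hr subrr.
move=> i; rewrite /components subl -/(components u (psi p) i) components_nu pE hr.
by rewrite mulrC divfK// subrr.
Qed.

Lemma height_bounded : exists C, forall p, height p <= C.
Proof.
have [b [z zM]] := @sphere_EVT _ height (fun b => smooth_cont (smooth_height b)).
by exists (height (chart b z)).
Qed.

(* The pole missed by the chart is reached by continuity. *)
Lemma height_constant r : (forall z, height_chart false z = r) ->
  forall p, height p = r.
Proof.
move=> hr p.
have ht x y : sqnorm x y != 0 -> height_chart true (x, y) = r.
  move=> n0; rewrite /height_chart -(chart_inversion true n0) /=.
  by rewrite -/(height_chart false _) hr.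
have h0 : height_chart true (0, 0) = r.
  have c1 := @continuous_slice1 _ _ 0 (smooth_cont (smooth_height true)).
  have lim : height_chart true (x, 0) @[x --> (0 : R)^'] --> r.
    apply: cvg_near_cst; near=> x; rewrite ht// /sqnorm mulr0 addr0 mulf_neq0//;
      near: x; exact: nbhs_dnbhs_neq.
  apply: (cvg_unique _ _ lim) => //.
  exact: cvg_within_filter (c1 0).
have [[] [[x y] _ ->]] := chart_surj p; last exact: hr.
have [/eqP|n0] := eqVneq (sqnorm x y) 0; last exact: ht.
rewrite /sqnorm -!expr2 paddr_eq0 ?sqr_ge0// !sqrf_eq0 => /andP[/eqP -> /eqP ->].
exact: h0.
Unshelve. all: by end_near. Qed.

End NormalMap.

(** * The area inequality *)

Section WeightedCauchySchwarz.
Context {R : realType}.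
Local Notation mu2 := (@lebesgue_measure R \x @lebesgue_measure R)%E.

(** Where f is positive it exceeds half its value on a small square, which has positive measure. *)
Lemma integral_eq0_continuous (f : R * R -> R) : continuous f ->
  (forall z, 0 <= f z) -> (\int[mu2]_z (f z)%:E = 0)%E -> forall z, f z = 0.
Proof.
move=> cf f0 If [x y]; apply/eqP; rewrite eq_le f0 andbT leNgt; apply/negP => fz.
pose d := f (x, y) / 2.
have d0 : 0 < d by rewrite divr_gt0.
have df : d < f (x, y) by rewrite /d; lra.
have nd : \forall z \near (x, y), d < f z.
  by apply: (cf (x, y) [set r | d < r]); exact: lt_nbhsr.
have /nbhs_ballP[e /= e0 eP] := nd.
pose I (c : R) : set R := `](c - e), (c + e)[%classic.
have mI c : measurable (I c) by exact: measurable_itv.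
have muI c : lebesgue_measure (I c) = (2 * e)%:E.
  rewrite /I lebesgue_measure_itv/= lte_fin ltrD2l gtrN// -EFinD.
  by congr (_%:E); ring.
have mB : measurable (I x `*` I y) by exact: measurableX.
have muB : mu2 (I x `*` I y) = (2 * e * (2 * e))%:E.
  rewrite product_measure1E; [|exact: mI..].
  by rewrite [RHS]EFinM; congr (_ * _)%E; exact: muI.
have mf : measurable_fun setT (EFin \o f).
  by apply/measurable_EFinP; exact: continuous_measurable2.
have : (0 < \int[mu2]_(z in I x `*` I y) (f z)%:E)%E.
  apply: (@lt_le_trans _ _ (\int[mu2]_(z in I x `*` I y) (cst d%:E) z)%E).
    have : (0 < d%:E * mu2 (I x `*` I y))%E.
      by rewrite muB -EFinM lte_fin !mulr_gt0.
    by rewrite integral_cst.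
  apply: ge0_le_integral => //.
  - by move=> z _; rewrite lee_fin ltW.
  - exact: measurable_funTS.
  - move=> [x' y'] [/=]; rewrite /I/= !in_itv/= => /andP[h1 h2] /andP[h3 h4].
    rewrite lee_fin; apply/ltW/eP.
    by split; rewrite /ball/= ltr_norml; apply/andP; split; lra.
apply/negP; rewrite -leNgt -If; apply: ge0_subset_integral => //.
by move=> z _; rewrite lee_fin.
Qed.

Variables (h j : R * R -> R) (C m : R).
Hypotheses (ch : continuous h) (cj : continuous j).
Hypotheses (h0 : forall z, 0 < h z) (hC : forall z, h z <= C).
Hypothesis j0 : forall z, 0 < j z.
Hypotheses (m0 : 0 < m) (jm : (\int[mu2]_z (j z)%:E = m%:E)%E).

Let ij : mu2.-integrable setT (EFin \o j).
Proof.
apply/integrableP; split; first by apply/measurable_EFinP; exact: continuous_measurable2.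
rewrite (_ : (\int[_]_z _)%E = m%:E) ?ltry// -jm; apply: eq_integral => z _.
by rewrite /= gtr0_norm.
Qed.

Let igj (g : R * R -> R) K : continuous g -> (forall z, `|g z| <= K) ->
  mu2.-integrable setT (fun z => (g z * j z)%:E).
Proof.
move=> cg gK; apply: (le_integrable _ _ _ (integrableZl measurableT K ij)) => //.
  apply/measurable_EFinP; apply: continuous_measurable2 => z.
  by apply: cvgM; [exact: cg|exact: cj].
move=> z _; rewrite -EFinM !abse_EFin lee_fin !normrM ler_wpM2r//.
exact: le_trans (gK z) (ler_norm _).
Qed.

(** Derived from the variance identity int (h^2 - c)^2 j = B - S^2 / m. In case of equality the
    continuous integrand vanishes at every point, and j > 0 leaves h^2 = c everywhere. *)
Lemma weighted_Cauchy_Schwarz : exists S B : R,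
  [/\ (\int[mu2]_z (h z ^+ 2 * j z)%:E = S%:E)%E,
      (\int[mu2]_z (h z ^+ 2 * (h z ^+ 2 * j z))%:E = B%:E)%E,
      0 <= S, 0 <= B & S ^+ 2 <= m * B /\
      (S ^+ 2 = m * B -> forall z, h z ^+ 2 = S / m)].
Proof.
have hh z : 0 <= h z by exact: ltW.
have C0 : 0 <= C by exact: le_trans (hC 0).
have ch2 : continuous (fun z => h z ^+ 2).
  by move=> z; apply: cvgM; exact: ch.
have ch4 : continuous (fun z => h z ^+ 2 * h z ^+ 2).
  by move=> z; apply: cvgM; exact: ch2.
have h2C z : `|h z ^+ 2| <= C ^+ 2.
  by rewrite ger0_norm ?sqr_ge0// ler_sqr ?nnegrE.
have i2 := igj ch2 h2C.
have i4 : mu2.-integrable setT (fun z => (h z ^+ 2 * (h z ^+ 2 * j z))%:E).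
  have h4C z : `|h z ^+ 2 * h z ^+ 2| <= C ^+ 2 * C ^+ 2.
    by rewrite normrM ler_pM.
  have := igj ch4 h4C; rewrite (_ : (fun z => _) =
    (fun z => (h z ^+ 2 * (h z ^+ 2 * j z))%:E))//.
  by apply/funext => z; rewrite mulrA.
pose S := fine (\int[mu2]_z (h z ^+ 2 * j z)%:E)%E.
pose B := fine (\int[mu2]_z (h z ^+ 2 * (h z ^+ 2 * j z))%:E)%E.
have SE : (\int[mu2]_z (h z ^+ 2 * j z)%:E = S%:E)%E.
  by rewrite /S fineK//; exact: integrable_fin_num.
have BE : (\int[mu2]_z (h z ^+ 2 * (h z ^+ 2 * j z))%:E = B%:E)%E.
  by rewrite /B fineK//; exact: integrable_fin_num.
have j0' z : 0 <= j z by exact: ltW.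
have S0 : 0 <= S.
  by rewrite -lee_fin -SE; apply: integral_ge0 => z _; rewrite lee_fin mulr_ge0// sqr_ge0.
have B0 : 0 <= B.
  rewrite -lee_fin -BE; apply: integral_ge0 => z _.
  by rewrite lee_fin !mulr_ge0// sqr_ge0.
(* The mean of h^2 for the weight [j]. *)
pose c := S / m.
pose q z := (h z ^+ 2 - c) ^+ 2 * j z.
have q0 z : 0 <= q z by rewrite mulr_ge0// sqr_ge0.
have cq : continuous q.
  have cd : continuous (fun z => h z ^+ 2 - c).
    by move=> z; apply: cvgB; [exact: ch2|exact: cvg_cst].
  move=> z; apply: cvgM; last exact: cj.
  by apply: cvgM; exact: cd.
have qE : (\int[mu2]_z (q z)%:E = (B - S ^+ 2 / m)%:E)%E.
  have i2c := integrableZl measurableT (- 2 * c) i2.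
  have i0c := integrableZl measurableT (c ^+ 2) ij.
  transitivity (\int[mu2]_z ((h z ^+ 2 * (h z ^+ 2 * j z))%:E +
     ((- 2 * c)%:E * (h z ^+ 2 * j z)%:E + (c ^+ 2)%:E * (j z)%:E)))%E.
    apply: eq_integral => z _; rewrite -!EFinM -!EFinD; congr (_%:E).
    by rewrite /q; ring.
  rewrite integralD//; last exact: integrableD.
  rewrite integralD// !integralZl// BE SE jm -!EFinM -!EFinD; congr (_%:E).
  by rewrite /c; field; rewrite gt_eqF.
exists S, B; split => //; split=> [|SB z].
  have : (0%:E <= (B - S ^+ 2 / m)%:E)%E.
    by rewrite -qE; apply: integral_ge0 => z _; rewrite lee_fin.
  by rewrite lee_fin subr_ge0 ler_pdivrMr// mulrC.
have : q z = 0.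
  apply: integral_eq0_continuous => //.
  by rewrite qE SB mulrAC divff ?gt_eqF// mul1r subrr.
move/eqP; rewrite /q mulf_eq0 [j z == 0]gt_eqF// orbF sqrf_eq0 subr_eq0.
by move/eqP.
Qed.

End WeightedCauchySchwarz.

Theorem proposition5p8 (R : realType) (psi : sphere2 R -> 'rV[R]_4)
    (psi_immersion : immersion psi) (psi_spacelike : spacelike psi)
    (psi_lightcone : range psi `<=` future_lightcone) (u : 'rV[R]_4)
    (u_unit : lorentz u u = -1) (u_past : u ord0 ord0 < 0) :
  (induced_area psi
     <= (2 * Num.sqrt pi)%:E * L2norm psi (fun p => lorentz (psi p) u))%E /\
  (induced_area psi
     = ((2 * Num.sqrt pi)%:E * L2norm psi (fun p => lorentz (psi p) u))%E
   <-> exists r : R, [/\ 0 < r, forall p, lorentz (psi p) u = r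
                       & range psi = lightcone_sphere u r]).
Proof.
pose h := height_chart psi u false.
pose j z := `|jacobian (nu_chart psi u false) z|.
have sn := smooth_nu psi_immersion psi_lightcone u_unit u_past.
have ch : continuous h by exact/smooth_cont/smooth_height.
have cj : continuous j.
  move=> z; apply: cvg_norm; apply: smooth_cont.
  exact: smooth_det3 (sn false) (vsmooth_vd1 (sn false)) (vsmooth_vd2 (sn false)).
have h0 z : 0 < h z by exact: height_gt0.
have [C hC] := height_bounded psi_immersion u.
have j0 z : 0 < j z by rewrite normr_gt0; exact: jacobian_nu_neq0.
have pi0 : 0 < 4 * pi :> R by rewrite mulr_gt0// pi_gt0.
have jm := integral_jacobian_nu psi_immersion psi_spacelike psi_lightcone u_unit u_past.
have [S [B [SE BE S0 B0 [SB SBeq]]]] :=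
  weighted_Cauchy_Schwarz ch cj h0 (fun z => hC (chart false z)) j0 pi0 jm.
have areaE := area_elementE psi_immersion psi_lightcone u_unit u_past false.
have -> : induced_area psi = S%:E.
  rewrite /induced_area /area_integral -SE; apply: eq_integral => z _.
  by rewrite mul1r areaE.
have -> : L2norm psi (fun p => lorentz (psi p) u) = (Num.sqrt B)%:E.
  rewrite /L2norm /area_integral.
  rewrite (_ : (\int[_]_z _)%E = B%:E)// -BE; apply: eq_integral => z _.
  by rewrite areaE.
(* With both sides written as square roots, the inequality and its equality case become those of S^2
   <= 4 pi B. *)
have rhsE : 2 * Num.sqrt pi * Num.sqrt B = Num.sqrt (4 * pi * B).
  by rewrite !sqrtrM ?mulr_ge0 ?pi_ge0// (_ : 4 = 2 ^+ 2) ?sqrtr_sqr ?gtr0_norm//; ring.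
have SS : S = Num.sqrt (S ^+ 2) by rewrite sqrtr_sqr ger0_norm.
have SBiff : S = Num.sqrt (4 * pi * B) <-> S ^+ 2 = 4 * pi * B.
  by split=> [->|<-//]; rewrite sqr_sqrtr// mulr_ge0// mulr_ge0// pi_ge0.
rewrite -EFinM rhsE lee_fin; split; first by rewrite {1}SS ler_wsqrtr.
split=> [[/SBiff/SBeq hc]|[r [r0 hr _]]].
  (* Equality makes h^2 constant, and positivity of h removes the square. *)
  have hr z : h z = h 0.
    by apply/eqP; rewrite -(eqrXn2 (ltn0Sn 1) (ltW (h0 _)) (ltW (h0 _))) !hc.
  have hp := height_constant psi_immersion hr.
  exists (h 0); split; [exact: h0|exact: hp|].
  exact: (range_of_constant_height psi_immersion psi_spacelike psi_lightcone
    u_unit u_past hp).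
have hz z : h z = r by exact: hr.
congr (_%:E); apply/SBiff.
(* For h = r both integrals are multiples of the total curvature: S = 4 pi r^2 and B = 4 pi r^4, so
   S^2 = 4 pi B. *)
have iZ (k : R) : (\int[@lebesgue_measure R \x @lebesgue_measure R]_z (k * j z)%:E =
    (k * (4 * pi))%:E)%E.
  under eq_integral do rewrite EFinM.
  rewrite integralZl//; first by rewrite jm EFinM.
  apply/integrableP; split; first by apply/measurable_EFinP; exact: continuous_measurable2.
  rewrite (_ : (\int[_]_z _)%E = (4 * pi)%:E) ?ltry// -jm.
  by apply: eq_integral => z _; rewrite /= normr_id.
have SrE : S = r ^+ 2 * (4 * pi).
  apply: EFin_inj; rewrite -SE -iZ; apply: eq_integral => z _.
  by rewrite hz.
have BrE : B = r ^+ 2 * r ^+ 2 * (4 * pi).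
  apply: EFin_inj; rewrite -BE -iZ; apply: eq_integral => z _.
  by rewrite hz mulrA.
rewrite SrE BrE; ring.
Qed.
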